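(* For every integer $t \ge 2$ there exists a real constant $c_t > 0$ such that for every simple graph $G$ and every function $f : V(G) \to \mathbb{Z}_{\ge 2}$ with maximum value at most $t$, we have $$a_f(G) \le d + c_t d^{3/4} (\log d)^{1/2},$$ where $d = \max\{\Delta_f(G), a(G)\}$.
   Context: For a graph $G$ and a function $f : V(G) \to \mathbb{Z}_{\ge 2}$, a degree-$f$ forest of $G$ is a spanning subgraph that is a forest in which every vertex $v$ has degree at most $f(v)$. The degree-$f$ arboricity $a_f(G)$ is the minimum number of colors in an edge-coloring of $G$ in which every color class is a degree-$f$ forest. The arboricity $a(G)$ is the minimum number of colors in an edge-coloring of $G$ in which every color class is a forest. $\Delta_f(G) = \max_{v \in V(G)} \lceil d(v)/f(v) \rceil$, where $d(v)$ is the degree of $v$. *)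

(* Defs.v *)
From HB Require Import structures.
From mathcomp Require Import all_boot all_order all_algebra.
From mathcomp Require Import boolp.

Set Implicit Arguments.
Unset Strict Implicit.
Unset Printing Implicit Defensive.

Import Order.TTheory GRing.Theory Num.Theory.

Record sgraph (V : finType) := SGraph {
  edges :> {set {set V}};
  card_edge : forall e, e \in edges -> #|e| = 2
}.

(* Spanning subgraphs are represented by their edge sets. *)

Definition adj (V : finType) (F : {set {set V}}) : rel V :=
  fun u v => [set u; v] \in F.

Definition deg (V : finType) (F : {set {set V}}) (v : V) : nat :=
  #|[set e in F | v \in e]|.

(* [ucycle] also accepts the closed sequences [::], [:: x] and [:: x; y], which
   are not cycles of a simple graph; hence the bound on the length. *)
Definition forest (V : finType) (F : {set {set V}}) : Prop :=
  forall s : seq V, ucycle (adj F) s -> size s < 3.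

Definition degree_forest (V : finType) (f : V -> nat) (F : {set {set V}}) : Prop :=
  forest F /\ forall v, deg F v <= f v.

(* A coloring is a function on all sets of vertices; only its values on edges
   matter. *)
Definition color_class (V : finType) (G : sgraph V) (c : {set V} -> nat) (i : nat)
  : {set {set V}} := [set e in G | c e == i].

Definition edge_colorable (V : finType) (G : sgraph V)
    (P : {set {set V}} -> Prop) (k : nat) : Prop :=
  exists c : {set V} -> nat,
    (forall e, e \in edges G -> c e < k) /\
    (forall i, i < k -> P (color_class G c i)).

Lemma forest_card_le1 (V : finType) (F : {set {set V}}) : #|F| <= 1 -> forest F.
Proof.
move=> /card_le1_eqP F1 [|x [|y [|z s]]] //= /andP[/= /and3P[xy yz _]].
rewrite !inE !negb_or => /andP[/and3P[nxy nxz _] _].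
have /setP/(_ x) := F1 _ _ xy yz.
by rewrite !inE eqxx (negPf nxy) (negPf nxz).
Qed.

Lemma degree_forest_card_le1 (V : finType) (f : V -> nat) (F : {set {set V}}) :
  (forall v, 2 <= f v) -> #|F| <= 1 -> degree_forest f F.
Proof.
move=> f2 F1; split=> [|v]; first exact: forest_card_le1.
apply: leq_trans (ltnW (f2 v)); apply: leq_trans F1.
by apply/subset_leq_card/subsetP => e; rewrite inE => /andP[].
Qed.

Lemma edge_colorable_ex (V : finType) (G : sgraph V) (P : {set {set V}} -> Prop) :
  (forall F : {set {set V}}, #|F| <= 1 -> P F) ->
  exists k, `[< edge_colorable G P k >].
Proof.
move=> P1; exists #|{: {set V}}|; apply/asboolP.
exists (fun e => nat_of_ord (enum_rank e)); split=> [e _|i _]; first exact: ltn_ord.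
apply: P1; apply/card_le1_eqP => e e'.
rewrite !inE => /andP[_ /eqP ei] /andP[_ /eqP e'i].
by apply/enum_rank_inj/val_inj; rewrite /= ei e'i.
Qed.

Definition arboricity (V : finType) (G : sgraph V) : nat :=
  ex_minn (edge_colorable_ex G (@forest_card_le1 V)).

(* The hypothesis on f ensures that the minimum exists. *)
Definition degree_arboricity (V : finType) (G : sgraph V) (f : V -> nat)
    (f_ge2 : forall v, 2 <= f v) : nat :=
  ex_minn (edge_colorable_ex G
    (fun F => @degree_forest_card_le1 V f F f_ge2)).

Definition max_degree_ratio (V : finType) (G : sgraph V) (f : V -> nat) : nat :=
  \max_(v : V) `|Num.ceil ((deg G v)%:R / (f v)%:R : rat)%R|%N.

(* Main.v *)
Require Import Defs.
From HB Require Import structures.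
From mathcomp Require Import all_boot all_order all_algebra.
From mathcomp Require Import zify ring lra boolp.
From mathcomp Require Import reals sequences exp.

Set Implicit Arguments.
Unset Strict Implicit.
Unset Printing Implicit Defensive.

Import Order.TTheory GRing.Theory Num.Theory.

(** A variant of Alon's argument for linear arboricity.  Since a forest on S has
    at most |S| edges, path reversal gives an orientation of G with outdegrees
    at most d and indegrees at most d (f v - 1).  Label the vertices by Z_p with
    p = L^2 and L a power of 2 close to d^(1/4), so that by the local lemma and
    a Chernoff bound the arcs at each vertex split evenly among the p classes
    given by the label differences.  By König's theorem each class splits into
    k ~ d / p colors with outdegree at most 1 and indegree at most f v - 1; a
    cycle of such a color is directed, and it has length at least L unless the
    label difference is one of the L multiples of L.  Applying the local lemma
    again, one arc of every cycle of length at least L can be removed so that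
    only O(d / L) of them meet a given vertex.  The removed arcs and the arcs in
    the L exceptional classes form a graph of maximum degree O(d / L), which is
    colored greedily by matchings. *)

(** * Orientations and König's edge coloring *)

(** Graphs are given by endpoint maps on a type of edges; fiber sizes of such maps serve as
    outdegrees, indegrees and bipartite degrees alike. *)
Definition fdeg (V E : finType) (g : E -> V) (v : V) : nat :=
  #|[set e | g e == v]|.

(** With the endpoint maps swapped, [tail t s o] is the head map of the same orientation. *)
Definition tail (V E : finType) (s t : E -> V) (o : {ffun E -> bool}) (e : E) : V :=
  if o e then s e else t e.

Lemma sum_fdeg (V E : finType) (g : E -> V) (S : {set V}) :
  \sum_(v in S) fdeg g v = #|[set e | g e \in S]|.
Proof.
rewrite -sum1_card (partition_big g (mem S)) /=; last by move=> e; rewrite inE.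
apply: eq_bigr => v vS; rewrite /fdeg -sum1_card; apply: eq_bigl => e.
by rewrite !inE andbC; case: eqP => //= ->.
Qed.

Lemma fdeg_sum (V E : finType) (g : E -> V) v : fdeg g v = \sum_e (g e == v).
Proof. by rewrite /fdeg -sum1_card big_mkcond; apply: eq_bigr => e _; rewrite inE; case: eqP. Qed.

Lemma tail_deg (V E : finType) (s t : E -> V) o v :
  fdeg (tail s t o) v + fdeg (tail t s o) v = fdeg s v + fdeg t v.
Proof.
rewrite !fdeg_sum -!big_split; apply: eq_bigr => e _ /=.
by rewrite /tail; case: (o e); lia.
Qed.

Definition oriented_adj (V E : finType) (s t : E -> V) (o : {ffun E -> bool}) : rel V :=
  fun u w => [exists e, (tail s t o e == u) && (tail t s o e == w)].

(** Reversing every arc of the path moves one unit of outdegree from [x] to the last vertex. The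
    second clause keeps the induction going: the first arc starts at [x], off the rest of the path,
    so the recursive step has not touched it. *)
Lemma reverse_path (V E : finType) (s t : E -> V) (o : {ffun E -> bool}) x p :
  path (oriented_adj s t o) x p -> uniq (x :: p) ->
  exists o' : {ffun E -> bool},
    (forall v, fdeg (tail s t o') v + (v == x) = fdeg (tail s t o) v + (v == last x p))
    /\ (forall e, ~~ ((s e \in x :: p) && (t e \in x :: p)) -> o' e = o e).
Proof.
elim: p x => [|y p IH] x; first by exists o.
move=> /= /andP[/existsP[e0 /andP[/eqP e0x /eqP e0y]] yp] /andP[xyp uyp].
have [o1 [o1d o1e]] := IH y yp uyp.
have o1e0 : o1 e0 = o e0.
  by apply: o1e; apply: contra xyp => /andP[? ?]; rewrite -e0x /tail; case: (o e0).
exists [ffun e => if e == e0 then ~~ o1 e else o1 e]; split=> [v|e he]; last first.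
  rewrite ffunE; case: eqP => [ee0|_].
    move: he; rewrite ee0.
    have: (s e0 \in x :: y :: p) /\ (t e0 \in x :: y :: p).
      by move: e0x e0y; rewrite /tail; case: (o e0) => -> ->; rewrite !inE !eqxx ?orbT.
    by move=> [-> ->].
  apply: o1e; apply: contra he => /andP[h1 h2].
  by rewrite inE h1 orbT /= inE h2 orbT.
set o' := finfun _.
have te0 : (tail s t o1 e0 = x) * (tail s t o' e0 = y).
  by rewrite -e0x -e0y /tail ffunE eqxx o1e0; case: (o e0).
have te e : e != e0 -> tail s t o' e = tail s t o1 e.
  by move=> /negPf ne; rewrite /tail ffunE ne.
rewrite -o1d !fdeg_sum (bigD1 e0) //= [in RHS](bigD1 e0) //= !te0.
rewrite (eq_bigr (fun e => nat_of_bool (tail s t o1 e == v))) => [|e /te -> //].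
by rewrite ![v == x]eq_sym ![v == y]eq_sym; lia.
Qed.

Definition excess (V E : finType) (s t : E -> V) (a b : V -> nat) o : nat :=
  \sum_v ((fdeg (tail s t o) v - a v) + (fdeg (tail t s o) v - b v)).

(** Reversing a path from [v] to a vertex of outdegree below its bound lowers the excess; the
    indegree of [v] stays admissible because the two bounds together cover its degree. If no such
    vertex is reachable, all arcs with tail in the reachable set [R] end in [R], so [R] spans more
    edges than allowed. *)
Lemma excess_decrease (V E : finType) (s t : E -> V) (a b : V -> nat) o v :
  (forall v, fdeg s v + fdeg t v <= a v + b v) ->
  (forall S : {set V}, #|[set e | (s e \in S) && (t e \in S)]| <= \sum_(v in S) a v) ->
  a v < fdeg (tail s t o) v ->
  exists o', excess s t a b o' < excess s t a b o.
Proof.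
move=> dab inS av.
pose R := [set u | connect (oriented_adj s t o) v u].
have vR : v \in R by rewrite inE connect0.
case: (boolP [exists u in R, fdeg (tail s t o) u < a u]) => [/existsP[u]|].
  rewrite inE => /andP[/connectP[p vp ->]]; case/shortenP: vp => q vq uq _ ua.
  have [o' [+ _]] := reverse_path vq uq.
  move: (last v q) ua => l al D; exists o'.
  have uv : (l == v) = false by apply/negP => /eqP uv; rewrite uv in al; lia.
  rewrite /excess (bigD1 v) //= [X in _ < X](bigD1 v) //= -addSn; apply: leq_add.
    have := tail_deg s t o v; have := tail_deg s t o' v; have := D v; have := dab v.
    by rewrite eqxx [v == _]eq_sym uv; lia.
  apply: leq_sum => w /negPf wv.
  have := tail_deg s t o w; have := tail_deg s t o' w; have := D w; have := dab w.
  by rewrite wv; case: eqP => [->|_] /=; lia.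
rewrite negb_exists => /forallP hR.
have : \sum_(u in R) fdeg (tail s t o) u <= \sum_(u in R) a u.
  apply: leq_trans (inS R); rewrite sum_fdeg; apply/subset_leq_card/subsetP => e.
  rewrite !inE => h.
  have h2 : connect (oriented_adj s t o) v (tail t s o e).
    by apply: connect_trans h (connect1 _); apply/existsP; exists e; rewrite !eqxx.
  by move: h h2; rewrite /tail; case: (o e) => -> ->.
rewrite leqNgt => /negP[]; rewrite (bigD1 v) //= [X in _ < X](bigD1 v) //= -addSn.
apply: leq_add => //; apply: leq_sum => u /andP[uR _].
by have := hR u; rewrite uR /= -leqNgt.
Qed.

(** In an orientation of minimal excess no bound is exceeded, since any overshoot could be reduced:
    a two-sided Hakimi-type criterion. *)
Lemma orientation_exists (V E : finType) (s t : E -> V) (a b : V -> nat) :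
  (forall v, fdeg s v + fdeg t v <= a v + b v) ->
  (forall S : {set V}, #|[set e | (s e \in S) && (t e \in S)]| <= \sum_(v in S) a v) ->
  (forall S : {set V}, #|[set e | (s e \in S) && (t e \in S)]| <= \sum_(v in S) b v) ->
  exists o, forall v, fdeg (tail s t o) v <= a v /\ fdeg (tail t s o) v <= b v.
Proof.
move=> dab inA inB.
pose o0 := [arg min_(o < [ffun=> true]) excess s t a b o].
have o0P o : excess s t a b o0 <= excess s t a b o.
  by rewrite /o0; case: arg_minnP => // o1 _; apply.
exists o0 => v; split; rewrite leqNgt; apply/negP => h.
  by have [o'] := excess_decrease dab inA h; rewrite ltnNge o0P.
(* Too large an indegree becomes too large an outdegree when [s], [t] and [a], [b] are exchanged,
   and the excess is symmetric under this exchange. *)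
have [||o'] := @excess_decrease V E t s b a o0 v _ _ h.
- by move=> w; rewrite addnC [b w + _]addnC.
- move=> S; apply: leq_trans (inB S); rewrite leq_eqVlt; apply/orP; left; apply/eqP.
  by apply: eq_card => e; rewrite !inE andbC.
have E1 o1 : excess t s b a o1 = excess s t a b o1 by apply: eq_bigr => w _; rewrite addnC.
by rewrite !E1 ltnNge o0P.
Qed.

(* Orient the bipartite graph on [U + W]: an edge is put in [M] when it points from
   [U] to [W].  The fractional solution [1 / (k + 1)] on every edge shows that the
   hypotheses of [orientation_exists] hold. *)
Lemma koenig_split (U W E : finType) (g : E -> U) (h : E -> W) (b : U -> nat) (c : W -> nat) k :
  (forall u, fdeg g u <= k.+1 * b u) -> (forall w, fdeg h w <= k.+1 * c w) ->
  exists M : {set E},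
    [/\ forall u, #|[set e in M | g e == u]| <= b u,
        forall w, #|[set e in M | h e == w]| <= c w,
        forall u, #|[set e in ~: M | g e == u]| <= k * b u &
        forall w, #|[set e in ~: M | h e == w]| <= k * c w].
Proof.
move=> gb hc.
pose s e : U + W := inl (g e); pose t e : U + W := inr (h e).
have sl u : fdeg s (inl u) = fdeg g u by [].
have sr w : fdeg s (inr w) = 0 by apply: eq_card0 => e; rewrite !inE.
have tr w : fdeg t (inr w) = fdeg h w by [].
have tl u : fdeg t (inl u) = 0 by apply: eq_card0 => e; rewrite !inE.
have key (S : {set U + W}) : 
    let n := #|[set e | (s e \in S) && (t e \in S)]| in
    n <= \sum_(v in S) (match v with inl u => k.+1 * b u | inr _ => 0 end) /\
    n <= \sum_(v in S) (match v with inl u => 0 | inr w => k.+1 * c w end).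
  split.
    apply: (@leq_trans (\sum_(v in S) fdeg s v)).
      by rewrite sum_fdeg; apply/subset_leq_card/subsetP => e; rewrite !inE => /andP[].
    by apply: leq_sum => -[u|w] _; rewrite ?sl ?sr.
  apply: (@leq_trans (\sum_(v in S) fdeg t v)).
    by rewrite sum_fdeg; apply/subset_leq_card/subsetP => e; rewrite !inE => /andP[].
  by apply: leq_sum => -[u|w] _; rewrite ?tl ?tr.
pose A (v : U + W) := match v with inl u => b u | inr w => k * c w end.
pose B (v : U + W) := match v with inl u => k * b u | inr w => c w end.
have [||| o oP] := @orientation_exists _ _ s t A B.
- by move=> [u|w] /=; rewrite ?sl ?sr ?tl ?tr; [have := gb u|have := hc w]; lia.
- move=> S; have [/= h1 h2] := key S.
  (* The first bound plus [k] times the second is exactly [k.+1] times the sum of [A]. *)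
  rewrite -(leq_pmul2l (ltn0Sn k)) mulSn.
  apply: leq_trans (leq_add h1 (leq_mul (leqnn k) h2)) _.
  rewrite !big_distrr /= -big_split /=; apply: leq_sum => -[u|w] _ /=; nia.
- move=> S; have [/= h1 h2] := key S.
  rewrite -(leq_pmul2l (ltn0Sn k)) mulSn addnC.
  apply: leq_trans (leq_add (leq_mul (leqnn k) h1) h2) _.
  rewrite !big_distrr /= -big_split /=; apply: leq_sum => -[u|w] _ /=; nia.
exists [set e | o e]; split=> v.
- have [h1 _] := oP (inl v); apply: leq_trans h1; apply/subset_leq_card/subsetP => e.
  rewrite !inE /tail => /andP[-> /eqP <-]; exact: eqxx.
- have [_ h1] := oP (inr v); apply: leq_trans h1; apply/subset_leq_card/subsetP => e.
  rewrite !inE /tail => /andP[-> /eqP <-]; exact: eqxx.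
- have [_ h1] := oP (inl v); apply: leq_trans h1; apply/subset_leq_card/subsetP => e.
  rewrite !inE /tail => /andP[/negPf -> /eqP <-]; exact: eqxx.
- have [h1 _] := oP (inr v); apply: leq_trans h1; apply/subset_leq_card/subsetP => e.
  rewrite !inE /tail => /andP[/negPf -> /eqP <-]; exact: eqxx.
Qed.

Lemma fdeg_sub (V E : finType) (P : pred E) (g : E -> V) v :
  fdeg (fun e : {e | P e} => g (val e)) v = #|[set e | P e && (g e == v)]|.
Proof.
rewrite /fdeg -(card_imset _ val_inj); apply: eq_card => e.
apply/imsetP/idP => [[x]|]; first by rewrite !inE => /eqP <- ->; rewrite (valP x) eqxx.
by rewrite inE => /andP[Pe ge]; exists (Sub e Pe); rewrite ?inE ?SubK.
Qed.

(** Split off one class at a time by [koenig_split], giving it the largest color. With both bounds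
    equal to 1 this is König's edge coloring theorem. *)
Lemma koenig_coloring k (U W E : finType) (g : E -> U) (h : E -> W)
    (b : U -> nat) (c : W -> nat) :
  (forall u, fdeg g u <= k * b u) -> (forall w, fdeg h w <= k * c w) ->
  exists col : E -> nat,
    [/\ forall e, col e < k,
        forall j u, #|[set e | (col e == j) && (g e == u)]| <= b u &
        forall j w, #|[set e | (col e == j) && (h e == w)]| <= c w].
Proof.
elim: k E g h => [|k IH] E g h gb hc.
  have noE (e : E) : false.
    have := gb (g e); rewrite mul0n leqn0 cards_eq0 => /eqP/setP/(_ e).
    by rewrite !inE eqxx.
  exists (fun=> 0); split=> [e|j u|j w]; first by have := noE e.
    by rewrite leqNgt; apply/negP => /(leq_ltn_trans (leq0n _)) /card_gt0P[e]; have := noE e.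
  by rewrite leqNgt; apply/negP => /(leq_ltn_trans (leq0n _)) /card_gt0P[e]; have := noE e.
have [M [M1 M2 M3 M4]] := koenig_split gb hc.
pose P : pred E := fun e => e \notin M.
have [||col [ck cb cc]] := IH {e | P e} (g \o val) (h \o val).
- move=> u; rewrite fdeg_sub; apply: leq_trans (M3 u).
  by apply/subset_leq_card/subsetP => e; rewrite !inE.
- move=> w; rewrite fdeg_sub; apply: leq_trans (M4 w).
  by apply/subset_leq_card/subsetP => e; rewrite !inE.
pose col' e := if @insub _ P {e | P e} e is Some x then col x else k.
have colM e : e \in M -> col' e = k.
  by move=> eM; rewrite /col' insubF // /P eM.
have colP e (Pe : P e) : col' e = col (Sub e Pe) by rewrite /col' insubT.
have gen (T : finType) (q : E -> T) (B : T -> nat) :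
    (forall v, #|[set e in M | q e == v]| <= B v) ->
    (forall j v, #|[set e | (col e == j) && ((q \o val) e == v)]| <= B v) ->
    forall j v, #|[set e | (col' e == j) && (q e == v)]| <= B v.
  move=> qM qc j v; case: (eqVneq j k) => [->|jk].
    apply: leq_trans (qM v); apply/subset_leq_card/subsetP => e; rewrite !inE => /andP[ek ->].
    rewrite andbT; apply: contraLR ek => eM; rewrite (colP e eM).
    by rewrite neq_ltn ck.
  apply: leq_trans (qc j v); rewrite -(card_imset _ val_inj).
  apply/subset_leq_card/subsetP => e; rewrite !inE => /andP[/eqP ej qe].
  have Pe : P e by apply/negP => /colM ek; rewrite -ej ek eqxx in jk.
  by apply/imsetP; exists (Sub e Pe); rewrite ?SubK // inE -colP ej eqxx /=.
exists col'; split; [|exact: gen|exact: gen].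
move=> e; case: (boolP (e \in M)) => [/colM ->//|eM]; rewrite (colP e eM).
exact: leq_trans (ck _) _.
Qed.

(** * Forests and matchings *)

Lemma forestS (V : finType) (F F' : {set {set V}}) :
  F \subset F' -> forest F' -> forest F.
Proof.
move=> /subsetP FF' forF' s /andP[cs us]; apply: forF'; rewrite /ucycle us andbT.
by apply: sub_cycle cs => x y /FF'.
Qed.

Lemma edge_other_end (V : finType) (e : {set V}) x :
  #|e| = 2 -> x \in e -> exists2 y, y != x & e = [set x; y].
Proof.
move=> e2 xe; have /eqP/cards1P[y ey] : #|e :\ x| = 1 by move: (cardsD1 x e); rewrite xe; lia.
exists y; first by have := set11 y; rewrite -ey !inE => /andP[].
by rewrite -ey setD1K.
Qed.

(** Extend a path at its first vertex by an edge other than the one just used: either a cycle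
    closes, or paths outgrow the number of vertices. *)
Lemma min_degree2_cycle (V : finType) (F : {set {set V}}) (S : {set V}) :
  (forall e, e \in F -> #|e| = 2 /\ e \subset S) -> S != set0 ->
  (forall v, v \in S -> 2 <= deg F v) -> ~ forest F.
Proof.
move=> FS /set0Pn[x0 x0S] F2 forF.
have long n : exists x p, [/\ x \in S, uniq (x :: p), path (adj F) x p & size p = n].
  elim: n => [|n [x [p [xS uxp pp <-]]]]; first by exists x0, [::].
  (* For empty [p] the default makes the excluded set the singleton of [x]; in any case at most one
     of the edges at [x] is lost. *)
  have /card_gt0P[e] : 0 < #|[set e in F | x \in e] :\ [set x; head x p]|.
    have := F2 x xS; rewrite /deg (cardsD1 [set x; head x p]).
    by case: (_ \in _); rewrite ?add1n ?ltnS // add0n; apply: leq_trans.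
  rewrite !inE => /and3P[ne eF xe].
  have [e2 eS] := FS e eF; have [y yx ey] := edge_other_end e2 xe.
  have yS : y \in S by rewrite (subsetP eS) // ey !inE eqxx orbT.
  case: (boolP (y \in p)) => [yp|yp]; last first.
    exists y, (x :: p); split=> //; first by rewrite cons_uniq inE (negPf yx) yp.
    by rewrite /= pp andbT /adj setUC -ey.
  case/splitPr: yp pp uxp ne => p1 p2; rewrite -cat_rcons cat_path => /andP[pp _] uxp ne.
  suff : size (x :: rcons p1 y) < 3.
    rewrite /= size_rcons; case: p1 {pp uxp} ne => //=.
    by rewrite ey eqxx.
  apply: forF; rewrite /ucycle /= rcons_path pp last_rcons /= /adj setUC -ey eF /=.
  by move: uxp; rewrite -cat_cons cat_uniq => /and3P[].
have [x [p [_ uxp _ sp]]] := long #|V|.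
by have := card_uniqP uxp; rewrite /= sp => h; have := max_card (mem (x :: p)); rewrite h; lia.
Qed.

(** Delete a vertex of degree at most 1, given by [min_degree2_cycle], and induct. The bound [#|S|]
    instead of [#|S| - 1] also fits the empty set. *)
Lemma forest_card (V : finType) (F : {set {set V}}) (S : {set V}) :
  (forall e, e \in F -> #|e| = 2 /\ e \subset S) -> forest F -> #|F| <= #|S|.
Proof.
move En : #|S| => n; elim: n => [|n IH] in F S En *; move=> FS forF.
  rewrite leqn0 cards_eq0; apply/eqP/setP => e; rewrite inE; apply/negP => /FS[e2].
  by move=> /subset_leq_card; rewrite e2 En.
have [v vS dv] : exists2 v, v \in S & deg F v <= 1.
  apply: contrapT => h; apply: (@min_degree2_cycle _ F S) => //.
    by rewrite -card_gt0 En.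
  by move=> v vS; rewrite ltnNge; apply/negP => dv; apply: h; exists v.
have := cardsID [set e : {set V} | v \in e] F.
have -> : F :&: [set e : {set V} | v \in e] = [set e in F | v \in e] by apply/setP => e; rewrite !inE.
have : #|F :\: [set e : {set V} | v \in e]| <= n.
  apply: (IH _ (S :\ v)); first by move: (cardsD1 v S); rewrite vS En; lia.
    move=> e; rewrite !inE => /andP[ve /FS[e2 eS]]; split=> //.
    by apply/subsetP => w we; rewrite !inE (subsetP eS) // andbT; apply: contraNneq ve => <-.
  by apply: forestS forF; apply: subsetDl.
by move=> Fn <-; rewrite -[n.+1]add1n; apply: leq_add.
Qed.

Lemma edges_inside_le (V : finType) (G : sgraph V) (S : {set V}) :
  #|[set e in edges G | e \subset S]| <= arboricity G * #|S|.
Proof.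
rewrite /arboricity; case: ex_minnP => k /asboolP[c [ck cF]] _.
(* [inord] needs a nonempty range, hence ['I_k.+1]; the extra class is empty. *)
rewrite -sum1_card (partition_big (fun e => inord (c e) : 'I_k.+1) xpredT) //=.
rewrite big_ord_recr /= [X in _ + X]big_pred0 ?addn0; last first.
  move=> e; rewrite inE; apply/negP => /andP[/andP[/ck ek _] /eqP/(congr1 val)] /=.
  by rewrite inordK; lia.
rewrite -[k in _ <= k * _]card_ord -sum_nat_const; apply: leq_sum => i _.
rewrite sum1_card.
apply: (@leq_trans #|[set e in color_class G c i | e \subset S]|).
  apply/subset_leq_card/subsetP => e; rewrite !inE unfold_in inE.
  move=> /andP[/andP[eG ->] /eqP/(congr1 val)]; rewrite /= eG inordK => [->|]; rewrite ?eqxx //.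
  by rewrite ltnW // ltnS ck.
apply: forest_card => [e|].
  by rewrite !inE => /andP[/andP[eG _] eS]; split=> //; apply: card_edge eG.
by apply: forestS (cF i (ltn_ord i)); apply/subsetP => e; rewrite inE => /andP[].
Qed.

Lemma disjoint_forest (V : finType) (F : {set {set V}}) :
  {in F &, forall e e' : {set V}, e != e' -> [disjoint e & e']} -> forest F.
Proof.
move=> dF [|x [|y [|z s]]] //= /andP[/= /and3P[xy yz _]].
rewrite !inE !negb_or => /andP[/and3P[nxy nxz _] _].
have : [set x; y] != [set y; z].
  by apply/eqP => /setP/(_ x); rewrite !inE eqxx (negPf nxy) (negPf nxz).
move=> /(dF _ _ xy yz) /pred0P/(_ y).
by rewrite /= !inE eqxx orbT.
Qed.

Lemma disjoint_deg (V : finType) (F : {set {set V}}) v :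
  {in F &, forall e e' : {set V}, e != e' -> [disjoint e & e']} -> deg F v <= 1.
Proof.
move=> dF; apply/card_le1_eqP => e e'; rewrite !inE => /andP[eF ve] /andP[e'F ve'].
apply/eqP; apply: contraT => ne; have /pred0P/(_ v) := dF _ _ e'F eF ne.
by rewrite /= ve ve'.
Qed.

(** Greedy coloring: an edge meets at most [2 * (D - 1)] others, so one of [2 * D] colors is free
    for it. *)
Lemma matching_coloring (V : finType) (F : {set {set V}}) (D : nat) :
  (forall e, e \in F -> #|e| = 2) -> (forall v, deg F v <= D) ->
  exists c : {set V} -> nat, (forall e, e \in F -> c e < 2 * D) /\
    {in F &, forall e e' : {set V}, e != e' -> c e = c e' -> [disjoint e & e']}.
Proof.
move En : #|F| => n; elim: n => [|n IH] in F En *; move=> F2 FD.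
  move/eqP: En; rewrite cards_eq0 => /eqP ->; exists (fun=> 0).
  by split=> [e|e e']; rewrite inE.
have /card_gt0P[e0 e0F] : 0 < #|F| by rewrite En.
have F'n : #|F :\ e0| = n by move: (cardsD1 e0 F); rewrite e0F En; lia.
have degD1 v : deg F v = (v \in e0) + deg (F :\ e0) v.
  rewrite /deg (cardsD1 e0) inE e0F /=; congr (_ + _); apply: eq_card => e.
  by rewrite !inE andbA.
have [e|v|c [cD cd]] := IH (F :\ e0) F'n.
- by rewrite inE => /andP[_ /F2].
- by apply: leq_trans (FD v); rewrite degD1 leq_addl.
have [x xe0] : exists x, x \in e0 by apply/card_gt0P; rewrite F2.
have [y yx e0y] := edge_other_end (F2 _ e0F) xe0.
have ye0 : y \in e0 by rewrite e0y !inE eqxx orbT.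
pose C := [set e in F :\ e0 | ~~ [disjoint e & e0]].
have CD : #|C| < 2 * D.
  have : #|C| <= deg (F :\ e0) x + deg (F :\ e0) y.
    apply: leq_trans (leq_card_setU _ _); apply/subset_leq_card/subsetP => e.
    rewrite inE => /andP[eF /pred0Pn[z /andP[/= ze zE]]].
    have : (z == x) || (z == y) by rewrite -in_set2 -e0y.
    by rewrite in_setU => /orP[] /eqP <-; apply/orP; [left|right]; rewrite inE eF.
  by have := FD x; have := FD y; rewrite !degD1 xe0 ye0; lia.
have [k kD kC] : exists2 k, k < 2 * D & k \notin [seq c e | e in C].
  apply: contrapT => h.
  have : size (iota 0 (2 * D)) <= size [seq c e | e in C].
    apply: uniq_leq_size (iota_uniq _ _) _ => k; rewrite mem_iota /= add0n => kD.
    by apply: contraT => kC; case: h; exists k.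
  by rewrite size_iota size_map -cardE leqNgt CD.
have disC e : e \in F :\ e0 -> c e = k -> [disjoint e & e0].
  move=> eF ck; apply: contraR kC => de; apply/imageP; exists e => //.
  by rewrite inE eF.
exists (fun e => if e == e0 then k else c e); split=> [e eF|e e' eF e'F].
  by case: eqP => // /eqP ee0; apply: cD; rewrite !inE ee0.
case: (eqVneq e e0) => [->|ee0]; case: (eqVneq e' e0) => [->|e'e0]; rewrite ?eqxx //.
- by move=> _ ck; rewrite disjoint_sym; apply: disC; rewrite // !inE e'e0.
- by move=> _ ck; apply: disC; rewrite // !inE ee0.
- by apply: cd; rewrite !inE ?ee0 ?e'e0.
Qed.

Lemma degree_arboricity_le (V : finType) (G : sgraph V) (f : V -> nat)
    (f_ge2 : forall v, 2 <= f v) k :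
  edge_colorable G (degree_forest f) k -> degree_arboricity G f_ge2 <= k.
Proof.
by move=> Gk; rewrite /degree_arboricity; case: ex_minnP => m _; apply; apply/asboolP.
Qed.

Lemma degree_arboricity_le_deg (V : finType) (G : sgraph V) (f : V -> nat)
    (f_ge2 : forall v, 2 <= f v) D :
  (forall v, deg G v <= D) -> degree_arboricity G f_ge2 <= 2 * D.
Proof.
move=> GD; apply: degree_arboricity_le.
have [c [cD cd]] := matching_coloring (@card_edge _ G) GD.
have dis i : {in color_class G c i &, forall e e' : {set V}, e != e' -> [disjoint e & e']}.
  move=> e e'; rewrite !inE => /andP[eG /eqP ei] /andP[e'G /eqP e'i] /cd; apply=> //.
  by rewrite ei.
exists c; split=> // i _; split=> [|v]; first exact: disjoint_forest.
by apply: leq_trans (disjoint_deg v (dis i)) (ltnW (f_ge2 v)).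
Qed.

(* When every vertex is the tail of at most one edge, the edges of a cycle on [S]
   have all of [S] as their tails; so it suffices that no [S] is sink-free. *)
Lemma forest_of_tails (V : finType) (F : {set {set V}}) (tl : {set V} -> V) :
  (forall e, e \in F -> tl e \in e) -> {in F &, injective tl} ->
  (forall S : {set V}, S != set0 ->
     exists2 v, v \in S & forall e, e \in F -> tl e = v -> ~~ (e \subset S)) ->
  forest F.
Proof.
move=> tle tlI noS s /andP[cs us]; rewrite ltnNge; apply/negP => s3.
pose E x := [set x; next s x].
have EF x : x \in s -> E x \in F by move=> xs; apply: (next_cycle cs xs).
(* Two vertices with the same edge would be each other's successor, which a cycle of length at least
   3 excludes. *)
have EI : {in s &, injective E}.
  move=> x y xs ys Exy; apply/eqP; apply: contraT => xy.
  have : x \in E y by rewrite -Exy !inE eqxx.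
  have : y \in E x by rewrite Exy !inE eqxx.
  rewrite !inE [y == x]eq_sym (negPf xy) /= => /eqP -> /eqP.
  have [i s' rs] := rot_to xs.
  have us' : uniq (rot i s) by rewrite rot_uniq.
  have ss' : 2 < size (rot i s) by rewrite size_rot.
  rewrite -!(next_rot i us); move: us' ss'; rewrite rs; case: s' {rs} => [|a [|b s']] //=.
  rewrite !inE !negb_or !eqxx => /and3P[/and3P[xa xb _] /andP[ab _] _] _.
  by rewrite [a == x]eq_sym (negPf xa) => xb'; rewrite xb' eqxx in xb.
pose S := [set x in s].
have ES x : x \in s -> E x \subset S.
  by move=> xs; apply/subsetP => y; rewrite !inE => /orP[] /eqP ->; rewrite ?mem_next.
have [|v vS hv] := noS S.
  have [x xs] : exists x, x \in s by case: (s) s3 => // x s' _; exists x; apply: mem_head.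
  by apply/set0Pn; exists x; rewrite inE.
have : v \in [set tl (E x) | x in S].
  suff -> : [set tl (E x) | x in S] = S by [].
  apply/eqP; rewrite eqEcard; apply/andP; split.
    apply/subsetP => y /imsetP[x]; rewrite inE => xs ->.
    by apply: (subsetP (ES x xs)); apply/tle/EF.
  rewrite card_in_imset // => x y; rewrite !inE => xs ys /tlI-/(_ (EF _ xs) (EF _ ys)).
  exact: EI.
move=> /imsetP[x]; rewrite inE => xs vx.
by have := hv (E x) (EF x xs) (esym vx); rewrite ES.
Qed.

(** * Orientation of the graph, and label differences along closed walks *)

(** The bounds [d] and [d * (f v).-1] add up to [d * f v], which covers the degree; since [f v] is
    at least 2, both are at least [d], so the arboricity controls the edges inside any set. *)
Lemma balanced_orientation (V : finType) (G : sgraph V) (f : V -> nat) (d : nat) :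
  (forall v, 2 <= f v) -> (forall v, deg G v <= d * f v) -> arboricity G <= d ->
  exists tl hd : {e : {set V} | e \in edges G} -> V,
    (forall e, val e = [set tl e; hd e]) /\
    (forall v, fdeg tl v <= d /\ fdeg hd v <= d * (f v).-1).
Proof.
move=> f2 dG aG.
have /boolp.choice[st stP] : forall e : {e : {set V} | e \in edges G},
    exists st : V * V, st.1 != st.2 /\ val e = [set st.1; st.2].
  move=> e; have /eqP/cards2P[x [y [xy ee]]] := card_edge (valP e).
  by exists (x, y).
pose s e := (st e).1; pose t e := (st e).2.
have degst v : fdeg s v + fdeg t v = deg G v.
  have fE (g : {e : {set V} | e \in edges G} -> V) :
    fdeg g v = #|val @: [set e | g e == v]| by rewrite card_imset //; apply: val_inj.
  rewrite !fE -cardsUI /deg.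
  rewrite [X in _ + X](_ : _ = 0) ?addn0.
    apply: eq_card => e; apply/setUP/idP.
      by rewrite inE => -[] /imsetP[x]; rewrite inE => /eqP <- ->;
        rewrite (valP x) (stP x).2 !inE eqxx ?orbT.
    rewrite inE => /andP[eG]; have := (stP (Sub e eG)).2; rewrite SubK => ee.
    rewrite {1}ee !inE => /orP[] /eqP ve; [left|right]; apply/imsetP;
      by exists (Sub e eG); rewrite ?SubK // inE /s /t ve.
  apply: eq_card0 => e; rewrite !inE; apply/negP => /andP[/imsetP[x]].
  rewrite inE => /eqP sx -> /imsetP[y]; rewrite inE => /eqP ty /val_inj xy.
  by move: (stP x).1; rewrite -/(s x) -/(t x) sx xy ty eqxx.
have inside (S : {set V}) (b : V -> nat) : (forall v, d <= b v) ->
    #|[set e | (s e \in S) && (t e \in S)]| <= \sum_(v in S) b v.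
  move=> db; apply: (@leq_trans (d * #|S|)); last first.
    by rewrite mulnC -sum_nat_const; apply: leq_sum.
  apply: (@leq_trans (arboricity G * #|S|)); last by rewrite leq_mul2r aG orbT.
  apply: leq_trans (edges_inside_le G S); rewrite -(card_imset _ val_inj).
  apply/subset_leq_card/subsetP => e /imsetP[x]; rewrite !inE => /andP[sx tx] ->.
  rewrite (valP x) (stP x).2; apply/subsetP => v; rewrite !inE.
  by case/orP => /eqP ->.
have [|||o oP] := @orientation_exists _ _ s t (fun=> d) (fun v => d * (f v).-1).
- by move=> v; rewrite degst; have := dG v; have := f2 v; nia.
- by move=> S; apply: inside.
- by move=> S; apply: inside => v; have := f2 v; nia.
exists (tail s t o), (tail t s o); split=> // e; rewrite /tail (stP e).2.
by case: (o e); rewrite // setUC.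
Qed.

(** For nonzero factors the exponents of [q] in [n] and [i] add up to at least [m + m], so one of
    them is at least [m]. *)
Lemma dvdn_half_pfactor q m n i : prime q ->
  q ^ (m + m) %| n * i -> (q ^ m %| n) || (q ^ m %| i).
Proof.
move=> pq; case: n => [|n]; first by rewrite dvdn0.
case: i => [|i]; first by rewrite dvdn0 orbT.
rewrite !pfactor_dvdn ?muln_gt0 // lognM //; lia.
Qed.

Lemma card_multiples n a b : 0 < a -> n = b * a -> #|[set i : 'I_n | a %| i]| <= b.
Proof.
move=> a0 nE.
have qb (i : 'I_n) : i %/ a < b by rewrite ltn_divLR // -nE.
rewrite -[b in _ <= b]card_ord -(@card_in_imset _ _ (fun i => Ordinal (qb i))) ?max_card //.
move=> i j; rewrite !inE => /divnK ei /divnK ej [ij].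
by apply: val_inj; rewrite /= -ei -ej ij.
Qed.

(** Each arc raises the label by [i], so returning after [n] arcs forces [q ^ (m + m)] to divide
    [n * i]. *)
Lemma closed_walk_length (V E : finType) (tl hd : E -> V) (h : V -> nat) (q m i : nat)
    (w : nat -> E) n :
  prime q ->
  (forall j, h (hd (w j)) = h (tl (w j)) + i %[mod q ^ (m + m)]) ->
  (forall j, tl (w j.+1) = hd (w j)) -> w n = w 0 -> 0 < n -> ~~ (q ^ m %| i) -> q ^ m <= n.
Proof.
move=> pq hw tw wn n0 /negPf ndiv; apply: dvdn_leq => //.
have walk j : h (tl (w j)) = h (tl (w 0)) + j * i %[mod q ^ (m + m)].
  elim: j => [|j IH]; first by rewrite mul0n addn0.
  by rewrite tw hw -modnDml IH modnDml mulSn addnAC addnA.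
have : q ^ (m + m) %| n * i.
  have /eqP := walk n; rewrite wn -[X in X == _ %[mod _]]addn0 eqn_modDl mod0n eq_sym.
  by [].
by move/(dvdn_half_pfactor pq); rewrite ndiv orbF.
Qed.

Lemma deg_imset_le (V : finType) (P : pred {set V}) (tl hd : {e | P e} -> V)
    (A : {set {e | P e}}) v :
  (forall x, val x = [set tl x; hd x]) ->
  deg (val @: A) v <= #|[set x in A | tl x == v]| + #|[set x in A | hd x == v]|.
Proof.
move=> xE; apply: leq_trans (leq_card_setU _ _); rewrite -(card_imset _ val_inj).
apply/subset_leq_card/subsetP => e; rewrite inE => /andP[/imsetP[x xA ->] vx].
by apply: imset_f; rewrite !inE xA /= ![_ == v]eq_sym -in_set2 -xE.
Qed.

Lemma card_bigcup_const (T X : finType) (A : {set T}) (B : {set X}) (q : T -> X) n :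
  (forall x, x \in B -> #|[set e in A | q e == x]| <= n) ->
  (forall e, e \in A -> q e \in B) -> #|A| <= #|B| * n.
Proof.
move=> Bn AB; rewrite -sum1_card (partition_big q (mem B)) //= -sum_nat_const.
apply: leq_sum => x xB; apply: leq_trans (Bn x xB).
by rewrite -sum1_card; apply: eq_leq; apply: eq_bigl => e; rewrite inE.
Qed.

Local Open Scope ring_scope.

(** * Local lemma and balanced labellings *)

(** Independence of events on disjoint sets of coordinates, in counting form: exchanging the
    coordinates in [S] between two functions is an involution matching [P] times [Q] with the pairs
    whose first member lies in both. *)
Lemma card_independent (I A : finType) (S : {set I}) (P Q : {set {ffun I -> A}}) :
  (forall h h' : {ffun I -> A}, {in S, h =1 h'} -> (h \in P) = (h' \in P)) ->
  (forall h h' : {ffun I -> A}, {in ~: S, h =1 h'} -> (h \in Q) = (h' \in Q)) ->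
  (#|P :&: Q| * #|{ffun I -> A}| = #|P| * #|Q|)%N.
Proof.
move=> PS QS.
pose swap (x : {ffun I -> A} * {ffun I -> A}) : {ffun I -> A} * {ffun I -> A} :=
  ([ffun i => if i \in S then x.1 i else x.2 i],
   [ffun i => if i \in S then x.2 i else x.1 i]).
have swapK : involutive swap.
  by move=> [h g]; congr (_, _); apply/ffunP => i; rewrite !ffunE /= ?ffunE;
    case: (i \in S).
rewrite -cardsT -!cardsX -(card_preimset (setX P Q) (inv_inj swapK)).
apply: eq_card => -[h g]; rewrite !inE /= andbT; congr (_ && _).
  by apply: PS => i iS; rewrite ffunE iS.
by apply: QS => i; rewrite inE ffunE => /negPf ->.
Qed.

Definition avoid (T X : finType) (B : X -> {set T}) (Y : {set X}) : {set T} :=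
  ~: \bigcup_(y in Y) B y.

Lemma avoidS (T X : finType) (B : X -> {set T}) (Y Z : {set X}) :
  Z \subset Y -> avoid B Y \subset avoid B Z.
Proof. by move=> ZY; rewrite setCS; apply/bigcupsP => y /(subsetP ZY) yY; apply: (bigcup_sup y). Qed.

Lemma card_avoid_le (T X : finType) (B : X -> {set T}) (Y Z : {set X}) :
  (#|avoid B Z| <= #|avoid B Y| + \sum_(y in Y :\: Z) #|B y :&: avoid B Z|)%N.
Proof.
have : avoid B Z \subset avoid B Y :|: \bigcup_(y in Y :\: Z) (B y :&: avoid B Z).
  apply/subsetP => h hZ; rewrite inE; case: (boolP (h \in avoid B Y)) => //=.
  rewrite inE negbK => /bigcupP[y yY hy]; apply/bigcupP; exists y; last by rewrite inE hy.
  rewrite inE yY andbT; apply/negP => yZ; move: hZ; rewrite inE => /negP[].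
  by apply/bigcupP; exists y.
move/subset_leq_card/leq_trans; apply; apply: leq_trans (leq_card_setU _ _) _.
rewrite leq_add2l.
apply: (big_ind2 (fun (C : {set T}) n => #|C| <= n)%N) => [|C n C' n' Cn Cn'|//].
  by rewrite cards0.
by apply: leq_trans (leq_card_setU _ _) _; apply: leq_add.
Qed.

(* The induction bounds by [2 * r] the probability of [B x] conditioned on avoiding
   any family of other events. *)
Lemma lovasz_local (R : realFieldType) (I A X : finType) (B : X -> {set {ffun I -> A}})
    (S : X -> {set I}) (D : nat) (r : R) :
  (0 < #|A|)%N ->
  (forall x (h h' : {ffun I -> A}), {in S x, h =1 h'} -> (h \in B x) = (h' \in B x)) ->
  (forall x, #|[set y | ~~ [disjoint S x & S y]]| <= D)%N ->
  (forall x, #|B x|%:R <= r * #|{ffun I -> A}|%:R) ->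
  0 <= r -> 4 * (D%:R + 1) * r <= 1 ->
  exists h, forall x, h \notin B x.
Proof.
move=> A0 BS SD Br r0 Dr.
pose a Y : R := #|avoid B Y|%:R.
have a0 Y : 0 <= a Y by exact: ler0n.
have O0 : 0 < #|{ffun I -> A}|%:R :> R by rewrite ltr0n card_ffun expn_gt0 A0.
have D0 : 0 <= D%:R :> R by exact: ler0n.
have claim n : forall (Y : {set X}) x, (#|Y| < n)%N -> #|B x :&: avoid B Y|%:R <= 2 * r * a Y.
  elim: n => // n IH Y x; rewrite ltnS => Yn.
  pose Z := Y :\: [set y | ~~ [disjoint S x & S y]].
  have indep : #|B x :&: avoid B Z|%:R <= r * a Z.
    rewrite -(ler_pM2r O0) -natrM (@card_independent _ _ (S x)); first 1 last.
    - exact: BS.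
    - move=> h h' hh'; rewrite !inE; congr (~~ _).
      apply/bigcupP/bigcupP => -[y yZ]; [move=> hy|move=> hy]; exists y => //;
      move: yZ; rewrite !inE negbK => /andP[dis _].
        rewrite -(BS y h) // => i iy; apply: hh'; rewrite inE.
        by apply: contraL iy => ix; rewrite (disjointFr dis).
      rewrite (BS y h h') // => i iy; apply: hh'; rewrite inE.
      by apply: contraL iy => ix; rewrite (disjointFr dis).
    by rewrite natrM mulrAC; apply: ler_wpM2r.
  have ZY : Z \subset Y by exact: subsetDl.
  have le1 : #|B x :&: avoid B Y|%:R <= #|B x :&: avoid B Z|%:R :> R.
    by rewrite ler_nat; apply/subset_leq_card/setIS/avoidS.
  apply: le_trans le1 (le_trans indep _).
  have [ZYe|ZYne] := eqVneq Z Y; first by rewrite ZYe; have := a0 Y; nra.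
  have Zn : (#|Z| < n)%N.
    by apply: leq_trans Yn; apply: proper_card; rewrite properEneq ZYne ZY.
  (* Passing from [Z] to [Y] adds at most [D] events, each of conditional probability at most
     [2 * r], so at most half is lost and [a Z <= 2 * a Y]. *)
  have : a Z <= a Y + D%:R * (2 * r * a Z).
    have := card_avoid_le B Y Z; rewrite -(ler_nat R) natrD natr_sum => /le_trans; apply.
    rewrite lerD2l; apply: (@le_trans _ _ (\sum_(y in Y :\: Z) 2 * r * a Z)).
      by apply: ler_sum => y _; apply: IH.
    rewrite sumr_const -[X in X <= _]mulr_natl; apply: ler_wpM2r.
      by rewrite !mulr_ge0.
    rewrite ler_nat; apply: leq_trans (SD x); apply/subset_leq_card/subsetP => y.
    by rewrite !inE; case: (y \in Y); rewrite ?andbT ?andbF // negbK.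
  move=> aZ; have Dr4 : D%:R * r <= 1 / 4 by lra.
  have : (D%:R * r) * a Z <= 1 / 4 * a Z by apply: ler_wpM2r.
  move=> Da; have -> : 2 * r * a Y = r * (2 * a Y) by ring.
  by apply: ler_wpM2l => //; lra.
(* Each further event removes at most the fraction [2 * r <= 1 / 2], so something always remains. *)
have pos n : forall Y : {set X}, #|Y| = n -> 0 < a Y.
  elim: n => [|n IH] Y Yn.
    have -> : Y = set0 by apply/eqP; rewrite -cards_eq0 Yn.
    by rewrite /a /avoid big_set0 setC0 cardsT.
  have /card_gt0P[x xY] : (0 < #|Y|)%N by rewrite Yn.
  have Y'n : #|Y :\ x| = n by move: (cardsD1 x Y); rewrite xY Yn; lia.
  have := claim n.+1 (Y :\ x) x; rewrite Y'n => /(_ (ltnSn _)).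
  have := IH _ Y'n.
  have := card_avoid_le B Y (Y :\ x); have -> : Y :\: (Y :\ x) = [set x].
    by apply/setP => y; rewrite !inE; case: eqVneq => [->|] //=; case: (y \in Y).
  rewrite big_set1 -(ler_nat R) natrD -/(a Y) -/(a (Y :\ x)); nra.
have := pos _ [set: X] erefl; rewrite ltr0n => /card_gt0P[h].
rewrite inE => hB; exists h => x; apply: contra hB => hx.
by apply/bigcupP; exists x.
Qed.

(** * Chernoff bound and balanced labels *)

(** Apply [1 + u <= expR u] to [u = x ^+ 2 - x] and use that (1 + x)(1 - x + x^2) = 1 + x^3 is at
    least 1. *)
Lemma expR_le1D (R : realType) (x : R) : 0 <= x -> expR (x - x ^+ 2) <= 1 + x.
Proof.
move=> x0; have := expR_ge1Dx (- (x - x ^+ 2)); rewrite expRN => h.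
have e0 := expR_gt0 (x - x ^+ 2).
rewrite -(ler_pM2l (_ : 0 < (expR (x - x ^+ 2))^-1)) ?invr_gt0 // mulVf ?gt_eqF //.
nra.
Qed.

(** Generating function of a binomial variable: for uniform [h], each [i] in [S] is hit
    independently with probability [1 / #|A|]. *)
Lemma sum_prod_hits (R : realFieldType) (I A : finType) (S : {set I}) (tau : I -> A) (y : R) :
  (0 < #|A|)%N ->
  \sum_(h : {ffun I -> A}) (1 + y) ^+ #|[set i in S | h i == tau i]|
    = (1 + y / #|A|%:R) ^+ #|S| * #|{ffun I -> A}|%:R.
Proof.
move=> A0.
have A1 : #|A|%:R != 0 :> R by rewrite pnatr_eq0 -lt0n.
pose F i a : R := if (i \in S) && (a == tau i) then 1 + y else 1.
transitivity (\sum_(h : {ffun I -> A}) \prod_i F i (h i)).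
  apply: eq_bigr => h _; rewrite -prodr_const big_mkcond /=.
  by apply: eq_bigr => i _; rewrite !inE.
rewrite -bigA_distr_bigA /= card_ffun natrX.
rewrite (eq_bigr (fun i => (if i \in S then 1 + y / #|A|%:R else 1) * #|A|%:R)).
  by rewrite big_split /= -big_mkcond /= !prodr_const.
move=> i _; rewrite /F; case: (i \in S) => /=; last by rewrite sumr_const mul1r.
rewrite (eq_bigr (fun a => 1 + if a == tau i then y else 0)); last first.
  by move=> a _; case: ifP => _; rewrite ?addr0.
rewrite big_split /= -big_mkcond big_pred1_eq sumr_const mulrDl mul1r divfK //.
Qed.

(** Markov's inequality for [1 + y] raised to the number of hits: [expR_le1D] bounds it from below
    on the event, and [expR_ge1Dx] bounds its mean from above. *)
Lemma chernoff_count (R : realType) (I A : finType) (S : {set I}) (tau : I -> A) (y z : R) :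
  (0 < #|A|)%N -> 0 <= y <= 1 ->
  #|[set h : {ffun I -> A} | z <= #|[set i in S | h i == tau i]|%:R]|%:R
    <= expR (y * (#|S|%:R / #|A|%:R) - (y - y ^+ 2) * z) * #|{ffun I -> A}|%:R.
Proof.
move=> A0 /andP[y0 y1]; set B := [set _ | _].
have yy0 : 0 <= y - y ^+ 2 by nra.
rewrite expRB mulrAC ler_pdivlMr ?expR_gt0 //.
apply: (@le_trans _ _ (\sum_(h : {ffun I -> A}) (1 + y) ^+ #|[set i in S | h i == tau i]|)).
  rewrite mulrC mulr_natr -sumr_const big_mkcond /=; apply: ler_sum => h _.
  rewrite inE; case: ifP => [zh|_]; last by rewrite exprn_ge0 // addr_ge0.
  apply: (@le_trans _ _ (expR (y - y ^+ 2) ^+ #|[set i in S | h i == tau i]|)).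
    by rewrite -expRM_natr ler_expR; apply: ler_wpM2l.
  by rewrite lerXn2r ?nnegrE ?expR_ge0 ?addr_ge0 // expR_le1D.
rewrite (sum_prod_hits S tau y A0); apply: ler_wpM2r => //.
rewrite mulrCA expRM_natl lerXn2r ?nnegrE ?expR_ge0 ?addr_ge0 ?divr_ge0 //.
exact: expR_ge1Dx.
Qed.

(** By the local lemma: an event depends on at most [N] labels, each occurring in at most [M]
    events. The target may vary with [i], as positions on cycles require. *)
Lemma balanced_labelling (R : realType) (I X A : finType) (S : X -> {set I})
    (tau : X -> I -> A) (N M : nat) (s : R) :
  (0 < #|A|)%N -> (forall x, #|S x| <= N)%N -> (forall i, #|[set x | i \in S x]| <= M)%N ->
  0 < s -> s <= 2 * (N%:R / #|A|%:R) ->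
  4 * ((N * M)%:R + 1) * expR (- (s ^+ 2 * #|A|%:R / (16 * N%:R))) <= 1 ->
  exists h : I -> A, forall x,
    #|[set i in S x | h i == tau x i]|%:R < #|S x|%:R / #|A|%:R + s.
Proof.
move=> A0 SN SM s0 sN small.
have q0 : 0 < #|A|%:R :> R by rewrite ltr0n.
have N0 : 0 < N%:R :> R.
  by move: (lt_le_trans s0 sN); rewrite pmulr_rgt0 // pmulr_lgt0 ?invr_gt0.
pose B x := [set h : {ffun I -> A} |
  #|S x|%:R / #|A|%:R + s <= #|[set i in S x | h i == tau x i]|%:R].
have [|||||h hB] := @lovasz_local R I A X B S (N * M)%N
    (expR (- (s ^+ 2 * #|A|%:R / (16 * N%:R)))) A0.
- move=> x h h' hh'; rewrite !inE; congr (_ <= _%:R); apply: eq_card => i.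
  by rewrite !inE; case: (boolP (i \in S x)) => //= /hh' ->.
- move=> x; apply: (@leq_trans #|\bigcup_(i in S x) [set y | i \in S y]|).
    apply/subset_leq_card/subsetP => y; rewrite inE => /pred0Pn[i /andP[ix iy]].
    by apply/bigcupP; exists i; rewrite ?inE.
  apply: (@leq_trans (\sum_(i in S x) M)); last by rewrite sum_nat_const leq_mul2r SN orbT.
  apply: (big_ind2 (fun (C : {set X}) n => #|C| <= n)%N) => [|C n C' n' Cn Cn'|i _].
  - by rewrite cards0.
  - by apply: leq_trans (leq_card_setU _ _) _; apply: leq_add.
  - exact: SM.
(* This [y] minimizes [y ^+ 2 * (N%:R / #|A|%:R) - y * s / 2], which bounds the exponent once
   [y <= 1 / 2]. *)
- move=> x; pose y := s * #|A|%:R / (4 * N%:R).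
  have y0 : 0 <= y by rewrite divr_ge0 ?mulr_ge0 // ltW.
  have yh : y <= 1 / 2.
    rewrite ler_pdivrMr ?mulr_gt0 //; move: sN; rewrite mulrA ler_pdivlMr //; lra.
  have y01 : 0 <= y <= 1 by apply/andP; split=> //; lra.
  apply: le_trans (chernoff_count (S x) (tau x) _ A0 y01) _; apply: ler_wpM2r => //.
  rewrite ler_expR.
  have -> : - (s ^+ 2 * #|A|%:R / (16 * N%:R)) = y ^+ 2 * (N%:R / #|A|%:R) - y * s / 2.
    rewrite /y; field; rewrite !gt_eqF //.
  have Sq : #|S x|%:R / #|A|%:R <= N%:R / #|A|%:R :> R.
    by rewrite ler_pM2r ?invr_gt0 // ler_nat.
  have := ler_wpM2l (sqr_ge0 y) Sq; have : y * s * y <= y * s * (1 / 2).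
    by apply: ler_wpM2l => //; apply: mulr_ge0 => //; apply: ltW.
  move: (#|S x|%:R / #|A|%:R) (N%:R / #|A|%:R) => u w; nra.
- exact: expR_ge0.
- exact: small.
exists h => x; have := hB x; rewrite inE -ltNge //.
Qed.

(** One event per vertex, label and side. Injectivity lets neighbors stand for arcs; a vertex lies
    in at most [N] neighborhoods, each used for [p] labels. *)
Lemma balanced_classes (R : realType) (V E : finType) (tl hd : E -> V) (p N : nat) (s : R) :
  (forall e e', tl e = tl e' -> hd e = hd e' -> e = e') ->
  (forall v, fdeg tl v + fdeg hd v <= N)%N ->
  (0 < p)%N -> 0 < s -> s <= 2 * (N%:R / p%:R) ->
  4 * ((N * (p * N))%:R + 1) * expR (- (s ^+ 2 * p%:R / (16 * N%:R))) <= 1 ->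
  exists h : V -> 'I_p, forall v a,
    #|[set e | (tl e == v) && (h (hd e) == a)]|%:R < (fdeg tl v)%:R / p%:R + s /\
    #|[set e | (hd e == v) && (h (tl e) == a)]|%:R < (fdeg hd v)%:R / p%:R + s.
Proof.
move=> inj dN p0 s0 sN small.
pose S (x : V * 'I_p * bool) : {set V} :=
  if x.2 then hd @: [set e | tl e == x.1.1] else tl @: [set e | hd e == x.1.1].
have cS x : #|S x| = (if x.2 then fdeg tl x.1.1 else fdeg hd x.1.1).
  rewrite /S; case: x.2; rewrite card_in_imset // => e e'; rewrite !inE => /eqP ev /eqP e'v ee.
    by apply: inj => //; rewrite ev e'v.
  by apply: inj => //; rewrite ev e'v.
have [||||||h hP] := @balanced_labelling R V _ 'I_p S (fun x _ => x.1.2) N (p * N) s.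
- by rewrite card_ord.
- by move=> x; rewrite cS; apply: leq_trans (dN x.1.1); case: x.2; rewrite ?leq_addr ?leq_addl.
- move=> w; apply: (@leq_trans
    #|[set (tl y.1, y.2, true) | y in setX [set e | hd e == w] [set: 'I_p]] :|:
      [set (hd y.1, y.2, false) | y in setX [set e | tl e == w] [set: 'I_p]]|).
    apply/subset_leq_card/subsetP => -[[v a] b]; rewrite inE /S; case: b => /=.
      case/imsetP => e; rewrite inE => /eqP <- ->; rewrite inE; apply/orP; left.
      by apply/imsetP; exists (e, a); rewrite // !inE eqxx.
    case/imsetP => e; rewrite inE => /eqP <- ->; rewrite inE; apply/orP; right.
    by apply/imsetP; exists (e, a); rewrite // !inE eqxx.
  apply: leq_trans (leq_card_setU _ _) _.
  apply: leq_trans (leq_add (leq_imset_card _ _) (leq_imset_card _ _)) _.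
  rewrite !cardsX cardsT card_ord -mulnDl mulnC leq_mul2l; apply/orP; right.
  by rewrite addnC; apply: dN.
- exact: s0.
- by rewrite card_ord.
- by rewrite card_ord.
exists h => v a; split.
  have := hP (v, a, true); rewrite cS /= card_ord; apply: le_lt_trans; rewrite ler_nat.
  rewrite -(@card_in_imset _ _ hd); last first.
    by move=> e e'; rewrite !inE => /andP[/eqP ev _] /andP[/eqP e'v _]; apply: inj; rewrite ev e'v.
  apply/subset_leq_card/subsetP => w /imsetP[e]; rewrite !inE => /andP[ev ha] ->.
  by rewrite ha andbT /S /=; apply: imset_f; rewrite inE.
have := hP (v, a, false); rewrite cS /= card_ord; apply: le_lt_trans; rewrite ler_nat.
rewrite -(@card_in_imset _ _ tl); last first.
  by move=> e e'; rewrite !inE => /andP[/eqP ev _] /andP[/eqP e'v _] ee; apply: inj; rewrite // ev e'v.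
apply/subset_leq_card/subsetP => w /imsetP[e]; rewrite !inE => /andP[ev ha] ->.
by rewrite ha andbT /S /=; apply: imset_f; rewrite inE.
Qed.

(** * Breaking the long cycles *)

(** At a vertex each color has at most one cycle arc on either side, so at most [#|C|] cycles matter
    there, and each loses that arc with probability at most [1 / l.+1]. Outside [D] a good color has
    no cycle left, so every nonempty set has a sink. *)
Lemma break_cycles (R : realType) (V E C : finType) (tl hd : E -> V) (col : E -> C)
    (good : pred C) (l : nat) (s : R) :
  (forall e e', col e = col e' -> tl e = tl e' -> e = e') ->
  (forall (w : nat -> E) n, (0 < n)%N -> w n = w 0%N -> good (col (w 0%N)) ->
    (forall j, col (w j) = col (w 0%N) /\ tl (w j.+1) = hd (w j)) -> (l < n)%N) ->
  0 < s -> s <= 2 * (#|C|%:R / l.+1%:R) ->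
  4 * ((#|C| * (2 * l.+1))%:R + 1) * expR (- (s ^+ 2 * l.+1%:R / (16 * #|C|%:R))) <= 1 ->
  exists D : {set E},
    (forall v, #|[set e in D | tl e == v]|%:R < #|C|%:R / l.+1%:R + s /\
               #|[set e in D | hd e == v]|%:R < #|C|%:R / l.+1%:R + s) /\
    (forall c (S : {set V}), good c -> S != set0 -> exists2 v, v \in S &
      forall e, col e = c -> tl e = v -> hd e \in S -> e \in D).
Proof.
move=> colI long s0 sC small.
(* Successor among the edges of the same color: the cycles of a color are the
   orbits [O e] of periodic edges. The label [h (O e)] of a cycle is the position
   in [enum (O e)] of its edge to be removed, among the first [l.+1] ones. *)
pose nxt e := odflt e [pick e' | (col e' == col e) && (tl e' == hd e)].
have colN e : col (nxt e) = col e.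
  by rewrite /nxt; case: pickP => //= e' /andP[/eqP].
have tlN e e' : col e' = col e -> tl e' = hd e -> nxt e = e'.
  move=> ce te; rewrite /nxt; case: pickP => [e'' /andP[/eqP ce'' /eqP te'']|/(_ e')] /=.
    by apply: colI; rewrite ?ce'' ?te''.
  by rewrite ce te !eqxx.
have Nfix e : tl (nxt e) != hd e -> nxt e = e.
  by rewrite /nxt; case: pickP => //= e' /andP[_ ->].
(* An arc without successor is a fixed point of [nxt]; the first condition keeps it from counting as
   a cycle. *)
pose cyc e := (tl (nxt e) == hd e) && (e \in fconnect nxt (nxt e)).
pose O e := [set x | fconnect nxt e x].
have eO e : e \in O e by rewrite inE connect0.
have nO e : nxt e \in O e by rewrite inE fconnect1.
have cycP e : cyc e -> fcycle nxt (orbit nxt e).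
  by case/andP => _ h; apply/(orbitPcycle 0 2).
have OE e x : cyc e -> x \in O e -> O x = O e.
  move=> ce xe; apply/setP => y; rewrite !inE [RHS]fconnect_orbit.
  by apply: (fconnect_cycle (cycP e ce)); rewrite -fconnect_orbit; rewrite inE in xe.
have colO e x : x \in O e -> col x = col e.
  rewrite inE => /iter_findex <-; elim: (findex _ _ _) => //= n IH.
  by rewrite colN.
have cycO e x : cyc e -> x \in O e -> cyc x.
  move=> ce xe; have Ox := OE e x ce xe.
  have nx : nxt x \in O e by rewrite -Ox.
  have -> : cyc x = (tl (nxt x) == hd x).
    rewrite /cyc; have -> : x \in fconnect nxt (nxt x) by move: xe; rewrite -(OE e (nxt x)) // inE.
    by rewrite andbT.
  apply: contraLR ce => /[dup] bx /Nfix xfix.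
  have : e \in O x by rewrite Ox.
  rewrite inE => /iter_findex; have -> n : iter n nxt x = x by elim: n => //= n ->.
  by move=> <-; rewrite /cyc (negPf bx).
have cardO e : cyc e -> good (col e) -> (l < #|O e|)%N.
  move=> ce ge; have /(orbitPcycle 0 4) oe := cycP e ce.
  have ite j : iter j nxt e \in O e by rewrite inE fconnect_iter.
  have -> : #|O e| = order nxt e by rewrite cardsE.
  apply: (long (fun j => iter j nxt e)) => // j.
  by split; [apply: colO|apply/eqP; case/andP: (cycO e _ ce (ite j))].
have nextI e e' : cyc e -> cyc e' -> nxt e = nxt e' -> e = e'.
  move=> ce ce' nn; have /(orbitPcycle 0 5) inj := cycP e ce.
  apply: inj => //; rewrite -fconnect_orbit ?connect0 //.
  by have := eO e'; rewrite -(OE e' (nxt e')) // -nn (OE e) // inE.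
pose g (b : bool) := if b then tl else hd.
have gI b e e' : cyc e -> cyc e' -> col e = col e' -> g b e = g b e' -> e = e'.
  case: b => /= ce ce' cc gg; first exact: colI.
  apply: nextI => //; apply: colI; first by rewrite !colN.
  by case/andP: ce => /eqP -> _; case/andP: ce' => /eqP -> _.
(* Only the first [l.+1] positions can be removed; restricting to them bounds by [2 * l.+1] the
   number of events in which an orbit occurs. *)
pose S (x : V * bool) : {set {set E}} := [set O e | e in
  [set e | [&& g x.2 e == x.1, cyc e & (index e (enum (O e)) < l.+1)%N]]].
(* On an orbit [Q] the picked arc is unique by [gI], and [tau] is its position; [ord0] is the
   default when there is no such arc. *)
pose tau (x : V * bool) (Q : {set E}) : 'I_l.+1 :=
  if [pick e in Q | (g x.2 e == x.1) && cyc e] is Some e then inord (index e (enum Q)) else ord0.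
have SC x : (#|S x| <= #|C|)%N.
  apply: leq_trans (leq_imset_card _ _) _.
  rewrite -(@card_in_imset _ _ col) ?max_card // => e e'; rewrite !inE.
  by move=> /and3P[/eqP ge ce _] /and3P[/eqP ge' ce' _] cc; apply: (gI x.2) => //; rewrite ge ge'.
have SM Q : (#|[set x | Q \in S x]| <= 2 * l.+1)%N.
  have [->|[e0 _]] := set_0Vmem Q.
    rewrite (_ : [set x | _] = set0) ?cards0 //; apply/setP => x; rewrite !inE.
    by apply/negP => /imsetP[e _ /setP/(_ e)]; rewrite eO inE.
  pose F (y : bool * 'I_l.+1) := (g y.1 (nth e0 (enum Q) y.2), y.1).
  have FM : (#|F @: [set: bool * 'I_l.+1]| <= 2 * l.+1)%N.
    by apply: leq_trans (leq_imset_card _ _) _; rewrite cardsT card_prod card_bool card_ord.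
  apply: leq_trans FM.
  apply/subset_leq_card/subsetP => -[v b]; rewrite inE => /imsetP[e].
  rewrite inE /= => /and3P[/eqP ge _ il] QO; apply/imsetP; exists (b, Ordinal il); first by rewrite inE.
  by rewrite /F /= QO nth_index ?ge // mem_enum.
have [||||||h hP] := @balanced_labelling R _ _ 'I_l.+1 S tau #|C| (2 * l.+1) s.
- by rewrite card_ord.
- exact: SC.
- exact: SM.
- exact: s0.
- by rewrite card_ord.
- by rewrite card_ord.
pose D := [set e | [&& cyc e, good (col e) & index e (enum (O e)) == h (O e)]].
have load b v : #|[set e in D | g b e == v]|%:R < #|C|%:R / l.+1%:R + s.
  have := hP (v, b); rewrite card_ord => hv; apply: le_lt_trans (lt_le_trans hv _); last first.
    by rewrite lerD2r ler_pM2r ?invr_gt0 ?ltr0n // ler_nat.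
  rewrite ler_nat -(@card_in_imset _ _ O); last first.
    move=> e e'; rewrite !inE => /andP[/and3P[ce _ _] /eqP ge] /andP[/and3P[ce' _ _] /eqP ge'] OO.
    by apply: (gI b) => //; rewrite ?ge ?ge' //; apply: colO; rewrite -OO eO.
  apply/subset_leq_card/subsetP => Q /imsetP[e]; rewrite !inE => /andP[/and3P[ce _ /eqP ie] /eqP ge] ->.
  have il : (index e (enum (O e)) < l.+1)%N by rewrite ie.
  rewrite imset_f ?inE ?ge ?ce ?il ?eqxx //=; apply/eqP/val_inj; rewrite /= -ie /tau /=.
  case: pickP => [e' /andP[e'O /andP[/eqP ge' ce']]|/(_ e)]; last by rewrite /= eO ge ce eqxx.
  suff -> : e' = e by rewrite inordK.
  by apply: (gI b) => //; [apply: colO|rewrite ge ge'].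
exists D; split=> [v|c A gc A0]; first by split; [apply: (load true)|apply: (load false)].
apply: contrapT => noS.
have noS' v : v \in A -> exists e, [/\ col e = c, tl e = v, hd e \in A & e \notin D].
  move=> vA; apply: contrapT => h'; apply: noS; exists v => // e ec ev eA.
  by apply: contrapT => /negP eD; apply: h'; exists e.
(* If every vertex of [A] keeps an arc of color [c] into [A], following successors from [e0] stays
   among such arcs and ends up on a cycle, whose removed arc lies in [D]. *)
pose inA e := [/\ col e = c, tl e \in A, hd e \in A & e \notin D].
have inAN e : inA e -> tl (nxt e) = hd e /\ inA (nxt e).
  case=> ec _ eA _; have [e' [e'c e'e e'A e'D]] := noS' _ eA.
  by rewrite (@tlN e e') ?e'c ?ec //; split=> //; split; rewrite ?e'e.
have [v0 v0A] := set0Pn _ A0; have [e0 [e0c e0v e0A e0D]] := noS' _ v0A.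
have inAit j : inA (iter j nxt e0).
  elim: j => [|j /inAN[]//]; split=> //; by rewrite e0v.
have [y [j yj yy]] : exists y, exists2 j, y = iter j nxt e0 & y \in fconnect nxt (nxt y).
  have /trajectP[i io ioe] := looping_order nxt e0.
  exists (iter i nxt e0); exists i => //; apply/(orbitPcycle 3 2).
  exists (order nxt e0 - i.+1)%N; rewrite -iterD -[RHS]ioe.
  by have -> : ((order nxt e0 - i.+1).+1 + i = order nxt e0)%N by move: io; lia.
have cy : cyc y by rewrite /cyc yy andbT yj; apply/eqP; case: (inAN _ (inAit j)).
have Oin x : x \in O y -> inA x.
  by rewrite inE => /iter_findex <-; rewrite yj -iterD; apply: inAit.
have gy : good (col y) by case: (Oin y (eO y)) => ->.
have := cardO y cy gy; rewrite cardE => lO.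
have hO : (h (O y) < size (enum (O y)))%N by apply: leq_trans lO; apply: ltn_ord.
have zO : nth y (enum (O y)) (h (O y)) \in O y by rewrite -mem_enum mem_nth.
case: (Oin _ zO) => zc _ _ /negP[]; rewrite inE (cycO y) //= zc gc /= (OE y) //.
by rewrite index_uniq ?enum_uniq.
Qed.

(** * Assembling the coloring *)

(* [s] is the deviation in the labelling of the vertices, [s'] the one in the choice
   of the removed edges, [D] the maximum degree of the leftover graph. *)
Lemma degree_arboricity_split (R : realType) (V : finType) (G : sgraph V) (f : V -> nat)
    (f_ge2 : forall v, (2 <= f v)%N) (t d m k D : nat) (s s' : R) :
  let L := (2 ^ m)%N in let p := (2 ^ (m + m))%N in
  (forall v, f v <= t)%N -> (forall v, deg G v <= d * f v)%N -> (arboricity G <= d)%N ->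
  0 < s -> s <= 2 * ((t * d)%:R / p%:R) ->
  4 * ((t * d * (p * (t * d)))%:R + 1) * expR (- (s ^+ 2 * p%:R / (16 * (t * d)%:R))) <= 1 ->
  d%:R / p%:R + s <= k%:R ->
  0 < s' -> s' <= 2 * ((p * k)%:R / L%:R) ->
  4 * ((p * k * (2 * L))%:R + 1) * expR (- (s' ^+ 2 * L%:R / (16 * (p * k)%:R))) <= 1 ->
  2 * ((p * k)%:R / L%:R + s') + (L * k * t)%:R <= D%:R ->
  (degree_arboricity G f_ge2 <= p * k + 2 * D)%N.
Proof.
move=> L p ft dG aG s0 sp small dk s'0 s'p small' DE.
have L0 : (0 < L)%N by rewrite expn_gt0.
have p0 : (0 < p)%N by rewrite expn_gt0.
have pLL : p = (L * L)%N by rewrite /p expnD.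
have [tl [hd [eE dD]]] := balanced_orientation f_ge2 dG aG.
have inj e e' : tl e = tl e' -> hd e = hd e' -> e = e'.
  by move=> te he; apply: val_inj; rewrite eE te he -eE.
have [|||h hP] := balanced_classes (s := s) (N := t * d) inj _ p0 s0.
- move=> v; have [o i] := dD v; apply: leq_trans (leq_add o i) _.
  by rewrite -mulnS mulnC leq_mul2r prednK ?ft ?orbT // ltnW.
- exact: sp.
- exact: small.
(* The class is the label difference modulo [p]; adding [p] avoids truncated subtraction. *)
pose cl e : 'I_p := Ordinal (ltn_pmod (h (hd e) + (p - h (tl e))) p0).
have clE e : h (hd e) = h (tl e) + cl e %[mod p].
  rewrite /= modnDmr addnCA subnKC ?modnDr //; exact: ltnW.
have cl_hd e e' : h (tl e) = h (tl e') -> cl e = cl e' -> h (hd e) = h (hd e').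
  move=> te ce; apply: val_inj; rewrite /= -[LHS](modn_small (ltn_ord _)) clE te ce -clE.
  by rewrite modn_small.
have cl_tl e e' : h (hd e) = h (hd e') -> cl e = cl e' -> h (tl e) = h (tl e').
  move=> he ce; apply/val_inj/eqP; rewrite /= -(modn_small (ltn_ord (h (tl e)))).
  by rewrite -(modn_small (ltn_ord (h (tl e')))) -(eqn_modDr (cl e)) -clE ce -clE he.
(* The deviation [s] occurs once, while [k * b] has room for [b] copies; used with [b = 1] for
   outdegrees and [b = (f v).-1] for indegrees. *)
have kr b : (0 < b)%N -> (d * b)%:R / p%:R + s <= (k * b)%:R.
  move=> b0; rewrite !natrM mulrAC; have b1 : 1 <= b%:R :> R by rewrite ler1n.
  apply: le_trans (ler_wpM2r _ dk); last exact: ler0n.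
  by rewrite mulrDl lerD2l ler_peMr // ltW.
have cl_out v i : (#|[set e | (tl e, cl e) == (v, i)]| <= k * 1)%N.
  case: (set_0Vmem [set e | (tl e, cl e) == (v, i)]) => [->|[e0]]; first by rewrite cards0.
  rewrite inE xpair_eqE => /andP[/eqP <- /eqP <-].
  have [+ _] := hP (tl e0) (h (hd e0)); rewrite -(ler_nat R) => hlt.
  apply: (@le_trans _ _ #|[set e | (tl e == tl e0) && (h (hd e) == h (hd e0))]|%:R).
    rewrite ler_nat; apply/subset_leq_card/subsetP => e; rewrite !inE xpair_eqE => /andP[/eqP te /eqP ce].
    by rewrite te eqxx (cl_hd e e0 _ ce) ?eqxx ?te.
  apply: le_trans (ltW hlt) _; apply: le_trans (kr 1%N isT); rewrite lerD2r ler_pM2r ?invr_gt0 ?ltr0n //.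
  by rewrite ler_nat muln1; have [] := dD (tl e0).
have cl_in v i : (#|[set e | (hd e, cl e) == (v, i)]| <= k * (f v).-1)%N.
  case: (set_0Vmem [set e | (hd e, cl e) == (v, i)]) => [->|[e0]]; first by rewrite cards0.
  rewrite inE xpair_eqE => /andP[/eqP <- /eqP <-].
  have [_ +] := hP (hd e0) (h (tl e0)); rewrite -(ler_nat R) => hlt.
  apply: (@le_trans _ _ #|[set e | (hd e == hd e0) && (h (tl e) == h (tl e0))]|%:R).
    rewrite ler_nat; apply/subset_leq_card/subsetP => e; rewrite !inE xpair_eqE => /andP[/eqP te /eqP ce].
    by rewrite te eqxx (cl_tl e e0 _ ce) ?eqxx ?te.
  apply: le_trans (ltW hlt) _; apply: le_trans (kr (f (hd e0)).-1 _); last by have := f_ge2 (hd e0); lia.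
  rewrite lerD2r ler_pM2r ?invr_gt0 ?ltr0n //.
  by rewrite ler_nat; have [] := dD (hd e0).
(* Pairing vertices with classes on both sides colors all [p] classes at once. *)
have [|| col [colk col_out col_in]] := @koenig_coloring k _ _ _ (fun e => (tl e, cl e))
    (fun e => (hd e, cl e)) (fun=> 1%N) (fun x => (f x.1).-1).
- by move=> [v i]; apply: cl_out.
- by move=> [v i]; apply: cl_in.
pose C : finType := ('I_p * 'I_k)%type.
pose kap e : C := (cl e, Ordinal (colk e)).
have kapI e e' : kap e = kap e' -> tl e = tl e' -> e = e'.
  move=> [cc ck] tt; have cE : cl e = cl e' by apply: val_inj.
  apply: (card_le1_eqP (col_out (col e) (tl e, cl e))); rewrite inE /=.
    by rewrite -ck -tt -cE eqxx xpair_eqE !eqxx.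
  by rewrite eqxx xpair_eqE !eqxx.
pose good (c : C) := ~~ (L %| c.1)%N.
have LE : ((2 ^ m).-1.+1 = L)%N by rewrite prednK.
have CE : #|C| = (p * k)%N by rewrite card_prod !card_ord.
have [||||B [BD Bfree]] := @break_cycles R V _ C tl hd kap good (2 ^ m).-1 s' kapI.
- move=> w n n0 wn gw kw; rewrite LE.
  apply: (@closed_walk_length _ _ tl hd (fun v => h v) 2 m (cl (w 0%N)) w) => // j.
    by have [kj _] := kw j; rewrite clE (congr1 fst kj : cl (w j) = cl (w 0%N)).
  by have [_] := kw j.
- by [].
- by rewrite CE LE.
- by rewrite CE LE.
rewrite CE LE in BD.
(* [J] is colored by matchings, using the colors from [p * k] on. *)
pose J := B :|: [set e | ~~ good (kap e)].
have badC : (#|[set c : C | ~~ good c]| <= L * k)%N.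
  pose M := setX [set i : 'I_p | (L %| i)%N] [set: 'I_k].
  have ML : (#|M| <= L * k)%N.
    by rewrite cardsX cardsT card_ord leq_mul2r (card_multiples L0 pLL) orbT.
  by apply: leq_trans ML; apply/subset_leq_card/subsetP => c; rewrite !inE negbK andbT.
have bad_le (g : {e | e \in edges G} -> V) v n :
    (forall c, #|[set e | (kap e == c) && (g e == v)]| <= n)%N ->
    (#|[set e | ~~ good (kap e) & g e == v]| <= L * k * n)%N.
  move=> gn; apply: (@leq_trans (#|[set c : C | ~~ good c]| * n)); last by rewrite leq_mul2r badC orbT.
  apply: (@card_bigcup_const _ _ _ _ kap) => [c _|e]; last by rewrite !inE => /andP[].
  apply: leq_trans (gn c); apply/subset_leq_card/subsetP => e.
  by rewrite !inE => /andP[/andP[_ ->] ->].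
have kap_out c v : (#|[set e | (kap e == c) && (tl e == v)]| <= 1)%N.
  apply/card_le1_eqP => e e'; rewrite !inE => /andP[/eqP ec /eqP ev] /andP[/eqP ec' /eqP ev'].
  by apply: kapI; rewrite ?ec ?ec' ?ev ?ev'.
have kap_in c v : (#|[set e | (kap e == c) && (hd e == v)]| <= (f v).-1)%N.
  apply: leq_trans (col_in c.2 (v, c.1)); apply/subset_leq_card/subsetP => e.
  by rewrite !inE => /andP[/eqP <- /eqP <-]; rewrite /= !eqxx.
have J_le (g : {e | e \in edges G} -> V) v :
    (#|[set e in J | g e == v]| <= #|[set e in B | g e == v]| + #|[set e | ~~ good (kap e) & g e == v]|)%N.
  apply: leq_trans (leq_card_setU _ _); apply/subset_leq_card/subsetP => e.
  by rewrite !inE => /andP[/orP[->|->] ->]; rewrite ?orbT.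
(* Each of the at most [L * k] exceptional colors has at most 1 outgoing and [(f v).-1] incoming
   arcs at [v], in total at most [L * k * t]. *)
have JD v : (deg (val @: J) v <= D)%N.
  apply: leq_trans (deg_imset_le J v eE) _; rewrite -(ler_nat R); apply: le_trans DE.
  have [B1 B2] := BD v.
  have := leq_add (leq_trans (J_le tl v) (leq_add (leqnn _) (bad_le tl v 1%N (kap_out^~ v))))
    (leq_trans (J_le hd v) (leq_add (leqnn _) (bad_le hd v _ (kap_in^~ v)))).
  rewrite -(ler_nat R) => /le_trans; apply.
  have : (L * k * 1 + L * k * (f v).-1 <= L * k * t)%N.
    rewrite -mulnDr leq_mul2l add1n prednK ?ft ?orbT //; exact: ltnW.
  rewrite -(ler_nat R) !natrD; lra.
have [|cJ [cJD cJd]] := matching_coloring _ JD.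
  by move=> e /imsetP[x _ ->]; apply: card_edge (valP x).
(* Euclidean division by [k] codes the pairs of class and color as the numbers below [p * k]. *)
pose c (e : {set V}) : nat := (if e \in val @: J then p * k + cJ e else
  if insub e is Some x then cl x * k + col x else 0)%N.
have cE x : x \notin J -> c (val x) = (cl x * k + col x)%N.
  by move=> xJ; rewrite /c mem_imset ?(negPf xJ) ?valK //; apply: val_inj.
have code_lt x : (cl x * k + col x < p * k)%N.
  apply: (@leq_trans (cl x * k + k)); first by rewrite ltn_add2l.
  by rewrite -mulSnr leq_mul2r ltn_ord orbT.
apply: degree_arboricity_le; exists c; split=> [e eG|i ipk].
  rewrite /c; case: ifP => [/cJD|_]; first by rewrite ltn_add2l.
  by rewrite insubT; apply: leq_trans (code_lt _) _; apply: leq_addr.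
case: (ltnP i (p * k)) => [ilt|ige]; last first.
  have dis : {in color_class G c i &, forall e e' : {set V}, e != e' -> [disjoint e & e']}.
    have inJ e : e \in color_class G c i -> e \in val @: J /\ c e = (p * k + cJ e)%N.
      rewrite !inE => /andP[eG /eqP ei]; have [eJ|eJ] := boolP (e \in val @: J).
        by rewrite /c eJ.
      move: ei; rewrite /c (negPf eJ) insubT => ei.
      by have := code_lt (Sub e eG); rewrite ei ltnNge ige.
    move=> e e' /[dup] ei /inJ[eJ ce] /[dup] e'i /inJ[e'J ce'] ne; apply: cJd => //.
    apply: (@addnI (p * k)); rewrite -ce -ce'; move: ei e'i; rewrite !inE.
    by move=> /andP[_ /eqP ->] /andP[_ /eqP ->].
  split=> [|v]; first exact: disjoint_forest.
  by apply: leq_trans (disjoint_deg v dis) (ltnW (f_ge2 v)).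
have [->|[e0 e0F]] := set_0Vmem (color_class G c i).
  split; first by apply: forest_card_le1; rewrite cards0.
  move=> v; rewrite /deg (_ : [set e : {set V} in set0 | v \in e] = set0) ?cards0 //.
  by apply/setP => e; rewrite !inE.
have Fval e : e \in color_class G c i -> exists x, [/\ val x = e, x \notin J,
    cl x = (i %/ k)%N :> nat & col x = (i %% k)%N].
  rewrite !inE => /andP[eG /eqP ei]; exists (Sub e eG); have [eJ|eJ] := boolP (e \in val @: J).
    by move: ilt; rewrite -ei /c eJ ltnNge leq_addr.
  have xJ : Sub e eG \notin J.
    by apply: contra eJ => xJ; apply/imsetP; exists (Sub e eG).
  have := cE _ xJ; rewrite SubK ei => iE; have ck := colk (Sub e eG).
  rewrite iE divnMDl ?(leq_ltn_trans _ ck) // divn_small // addn0 modnMDl modn_small //.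
have [x0 [_ x0J cl0 col0]] := Fval _ e0F.
have Fkap e : e \in color_class G c i ->
    exists x, [/\ val x = e, x \notin J & kap x = kap x0].
  move=> /Fval[x [xe xJ clx colx]]; exists x; split=> //; congr (_, _); apply: val_inj.
    exact: etrans clx (esym cl0).
  exact: etrans colx (esym col0).
have g0 : good (kap x0) by apply: contraR x0J => bad; rewrite !inE bad orbT.
pose tlV (e : {set V}) := if insub e is Some x then tl x else tl x0.
have tlVE x : tlV (val x) = tl x by rewrite /tlV valK.
split.
  apply: (@forest_of_tails _ _ tlV) => [e|e e'|A A0].
  - by move=> /Fkap[x [<- _ _]]; rewrite tlVE eE !inE eqxx.
  - move=> /Fkap[x [<- _ kx]] /Fkap[x' [<- _ kx']]; rewrite !tlVE => tt.
    by rewrite (kapI x x') // kx kx'.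
  have [v vA vB] := Bfree _ A g0 A0; exists v => // e /Fkap[x [<- xJ kx]].
  rewrite tlVE => xv; apply: contra xJ => /subsetP xA; rewrite inE vB //.
  by apply: xA; rewrite eE !inE eqxx orbT.
move=> v; pose A := [set x | kap x == kap x0].
have FA : color_class G c i \subset val @: A.
  by apply/subsetP => e /Fkap[x [<- _ kx]]; apply: imset_f; rewrite inE kx.
apply: (@leq_trans (deg (val @: A) v)).
  apply/subset_leq_card/subsetP => e; rewrite !inE -andbA => /and3P[eG ei ->].
  by rewrite andbT (subsetP FA) // !inE eG.
apply: leq_trans (deg_imset_le A v eE) _.
have := leq_add (kap_out (kap x0) v) (kap_in (kap x0) v).
rewrite add1n prednK; last by apply: ltnW.
apply: leq_trans; apply: leq_add; apply/subset_leq_card/subsetP => x;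
  by rewrite !inE.
Qed.

(** * Choice of the parameters *)

(** Local lemma condition for breaking cycles, with [z = L * k]. The exponential is at least the
    fourth power of [1 + z / 16], which wins because [z] is at least [y ^+ 3 / 2] and [L] at most
    [2 * y]. *)
Lemma poly_le_expR (R : realType) (y L z : R) :
  256 <= y -> 0 <= L <= 2 * y -> y ^+ 3 <= 2 * z ->
  4 * (2 * L ^+ 2 * z + 1) * expR (- (z / 4)) <= 1.
Proof.
move=> y256 /andP[L0 Ly] yz.
have y0 : 0 <= y by lra.
have z0 : 0 <= z by have := exprn_ge0 3 y0; lra.
rewrite expRN ler_pdivrMr ?expR_gt0 // mul1r.
have -> : z / 4 = 4%:R * (z / 16) by field.
rewrite expRM_natl; apply: le_trans (lerXn2r _ _ _ (expR_ge1Dx (z / 16))); last 2 first.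
- by rewrite nnegrE; lra.
- by rewrite nnegrE expR_ge0.
pose a := z / 16.
have L2 : L ^+ 2 <= 4 * y ^+ 2 by rewrite !expr2; nra.
have y2 : 256 * y <= y ^+ 2 by rewrite expr2; nra.
have y3 : 256 * y ^+ 2 <= y ^+ 3 by rewrite [y ^+ 3]exprS; apply: ler_wpM2r => //; apply: sqr_ge0.
have a8 : 8 * y ^+ 2 <= 1 + a by rewrite /a; lra.
have a1 : 64 <= 1 + a by lra.
have s1 : 64 * (1 + a) <= (1 + a) ^+ 2 by rewrite expr2; apply: ler_wpM2r => //; lra.
have -> : z = 16 * a by rewrite /a; field.
have -> : (16 * a) / 16 = a by field.
have La : 2 * L ^+ 2 * (16 * a) <= 16 * (1 + a) * a.
  have -> : 2 * L ^+ 2 * (16 * a) = (32 * L ^+ 2) * a by ring.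
  by apply: ler_wpM2r; lra.
have -> : (1 + a) ^+ 4 = (1 + a) ^+ 2 * (1 + a) ^+ 2 by ring.
have : 4096 * (1 + a) ^+ 2 <= (1 + a) ^+ 2 * (1 + a) ^+ 2.
  by apply: ler_wpM2r; [apply: sqr_ge0|lra].
have : (1 + a) ^+ 2 = (1 + a) * a + 1 + a by ring.
have : 0 <= (1 + a) * a by apply: mulr_ge0; lra.
lra.
Qed.

(** Local lemma condition for the vertex labels, where [y ^+ 4] is [d] and the exponential is d^-4:
    the left side is at most [20 * y ^+ 12]. *)
Lemma poly_le_expr16 (R : realFieldType) (y L t : R) :
  256 + t <= y -> 0 <= t -> 0 <= L <= 2 * y ->
  4 * (t * y ^+ 4 * (L ^+ 2 * (t * y ^+ 4)) + 1) <= (y ^+ 4) ^+ 4.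
Proof.
move=> ty t0 /andP[L0 Ly].
have y0 : 0 <= y by lra.
have t2 : t ^+ 2 <= y ^+ 2 by rewrite lerXn2r ?nnegrE //; lra.
have L2 : L ^+ 2 <= 4 * y ^+ 2 by rewrite !expr2; nra.
have tL : t ^+ 2 * L ^+ 2 <= y ^+ 2 * (4 * y ^+ 2) by apply: ler_pM; rewrite ?sqr_ge0.
have y8 : 0 <= y ^+ 8 by apply: exprn_ge0.
have := ler_wpM2r y8 tL.
have -> : (y ^+ 4) ^+ 4 = y ^+ 12 * y ^+ 4 by ring.
have y4 : 20 <= y ^+ 4.
  have : 256 ^+ 4 <= y ^+ 4 by rewrite lerXn2r ?nnegrE //; lra.
  by apply: le_trans; rewrite !exprS expr0; lra.
have y12 : 1 <= y ^+ 12 by apply: exprn_ege1; lra.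
have : 20 * y ^+ 12 <= y ^+ 12 * y ^+ 4 by rewrite mulrC; apply: ler_wpM2l => //; lra.
have -> : y ^+ 2 * (4 * y ^+ 2) * y ^+ 8 = 4 * y ^+ 12 by ring.
have -> : t * y ^+ 4 * (L ^+ 2 * (t * y ^+ 4)) = t ^+ 2 * L ^+ 2 * y ^+ 8 by ring.
lra.
Qed.

Lemma exists_pow2_between (R : realFieldType) (d : nat) (y : R) :
  1 <= y -> d%:R = y ^+ 4 -> exists m, y <= (2 ^ m)%:R <= 2 * y.
Proof.
move=> y1 dy; have y0 : 0 <= y by lra.
have exm : exists m, (d <= (2 ^ m) ^ 4)%N.
  exists d; apply: leq_trans (ltnW (ltn_expl d (ltnSn 1))) _.
  by rewrite -expnM leq_exp2l // leq_pmulr.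
have [m dm mmin] := ex_minnP exm; exists m; apply/andP; split.
  by rewrite -(@ler_pXn2r _ 4) ?nnegrE // -dy -natrX ler_nat.
case: m dm mmin => [|m] _ mmin; first by rewrite expn0; lra.
have /ltnW : ((2 ^ m) ^ 4 < d)%N by rewrite ltnNge; apply/negP => /mmin; rewrite ltnn.
rewrite -(ler_nat R) dy natrX ler_pXn2r ?nnegrE // => h; rewrite expnS natrM.
by apply: ler_wpM2l.
Qed.

(* Here [y = d^(1/4)] and [w = (ln d)^(1/2)]. *)
Lemma degree_arboricity_large (R : realType) (V : finType) (G : sgraph V) (f : V -> nat)
    (f_ge2 : forall v, (2 <= f v)%N) (t d : nat) (y w : R) :
  (2 <= t)%N -> (forall v, f v <= t)%N -> (forall v, deg G v <= d * f v)%N ->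
  (arboricity G <= d)%N -> 256 + t%:R <= y -> d%:R = y ^+ 4 -> 0 < w -> w ^+ 2 = ln d%:R ->
  (degree_arboricity G f_ge2)%:R
    <= y ^+ 4 + y ^+ 3 * (16 * t%:R * w + (4 + 2 * (6 + t%:R) * (t%:R + 3))).
Proof.
move=> t2 ft dG aG ty dy w0 wd.
have t2r : 2 <= t%:R :> R by rewrite ler_nat.
have y0 : 0 < y by lra.
have x0 : 0 < y ^+ 4 by apply: exprn_gt0.
have [m /andP[]] := exists_pow2_between (ltac:(lra) : 1 <= y) dy.
set L := (2 ^ m)%N => yL Ly.
have L0 : 0 < L%:R :> R by lra.
have pL : (2 ^ (m + m))%:R = L%:R ^+ 2 :> R by rewrite expnD natrM expr2.
have [tau tau0 tauE] : exists2 tau : R, 1 <= tau & tau ^+ 2 = t%:R.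
  exists (Num.sqrt t%:R); last by rewrite sqr_sqrtr.
  have t1 : 1 <= t%:R :> R by lra.
  by have := ler_wsqrtr t1; rewrite sqrtr1.
have taut : tau <= t%:R by rewrite -tauE expr2; nra.
(* Since w^2 = 4 ln y, w^2 is at most 4 y; this keeps [s] in the range where the Chernoff bound
   applies. *)
have w8 : 8 * w <= y.
  have e4 : expR (w ^+ 2 / 4) = y.
    apply/eqP; rewrite -(@eqrXn2 _ 4) ?expR_ge0 ?(ltW y0) // -expRM_natl.
    have -> : 4%:R * (w ^+ 2 / 4) = w ^+ 2 by field.
    by rewrite wd lnK ?posrE dy.
  have := expR_ge1Dx (w ^+ 2 / 4); rewrite e4 => h.
  have y2 : 256 * y <= y ^+ 2 by rewrite expr2; apply: ler_wpM2r; lra.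
  by rewrite -(@ler_pXn2r _ 2) ?nnegrE //; lra.
(* Makes the exponent s^2 p / (16 t d) equal to 4 ln d; the factor [tau] cancels [t]. *)
pose s : R := 8 * (tau * y ^+ 2 * w) / L%:R.
have s0 : 0 < s.
  by rewrite /s divr_gt0 // !mulr_gt0 // ?exprn_gt0 //; lra.
(* Rounding up costs at most 1 in [k], hence at most [L ^+ 2 <= 4 * y ^+ 2] colors. *)
pose k := (Num.truncn (d%:R / L%:R ^+ 2 + s)).+1.
have z0 : 0 <= d%:R / L%:R ^+ 2 + s.
  by apply: addr_ge0; [rewrite divr_ge0 ?sqr_ge0|apply: ltW].
have /andP[kle klt] := truncn_itv z0.
have k0 : 0 < k%:R :> R by rewrite ltr0n.
have kgt : d%:R / L%:R ^+ 2 + s < k%:R := klt.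
have kup : k%:R <= d%:R / L%:R ^+ 2 + s + 1 by rewrite /k -natr1 lerD2r.
have sL : s * L%:R = 8 * (tau * y ^+ 2 * w) by rewrite /s divfK // gt_eqF.
clearbody k s; clear kle klt z0.
have L20 : 0 < L%:R ^+ 2 :> R by rewrite exprn_gt0.
have y2 : 0 <= y ^+ 2 by apply: sqr_ge0.
have y3 : 0 <= y ^+ 3 by apply: exprn_ge0; apply: ltW.
have sLw : s * L%:R ^+ 2 <= 16 * tau * y ^+ 3 * w.
  rewrite [L%:R ^+ 2]expr2 mulrA sL.
  have -> : 16 * tau * y ^+ 3 * w = 8 * (tau * y ^+ 2 * w) * (2 * y) by ring.
  by apply: ler_wpM2l => //; rewrite !mulr_ge0 //; lra.
have sLt : s * L%:R <= tau * y ^+ 3.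
  rewrite sL; have -> : 8 * (tau * y ^+ 2 * w) = (tau * y ^+ 2) * (8 * w) by ring.
  have -> : tau * y ^+ 3 = (tau * y ^+ 2) * y by ring.
  by apply: ler_wpM2l => //; rewrite mulr_ge0 //; lra.
have Lk1 : y ^+ 3 <= 2 * (L%:R * k%:R).
  have h : d%:R / L%:R ^+ 2 < k%:R :> R by apply: lt_trans kgt; rewrite ltrDl.
  have : y ^+ 4 < k%:R * L%:R ^+ 2 by rewrite -dy -ltr_pdivrMr // exprn_gt0.
  have : k%:R * L%:R ^+ 2 <= 2 * (L%:R * k%:R) * y.
    have -> : k%:R * L%:R ^+ 2 = L%:R * k%:R * L%:R :> R by ring.
    have -> : 2 * (L%:R * k%:R) * y = L%:R * k%:R * (2 * y) :> R by ring.
    by apply: ler_wpM2l => //; rewrite mulr_ge0 // ltW.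
  move=> h1 h2; have := ltW (lt_le_trans h2 h1); rewrite [y ^+ 4]exprSr ler_pM2r //.
have L2k : L%:R ^+ 2 * k%:R <= y ^+ 4 + s * L%:R ^+ 2 + L%:R ^+ 2.
  have := ler_wpM2l (ltW L20) kup; move/le_trans; apply.
  by rewrite !mulrDr mulrCA divff ?gt_eqF // !mulr1 dy [_ * s]mulrC.
have L2y : L%:R ^+ 2 <= 4 * y ^+ 2 by rewrite !expr2; nra.
have y23 : y ^+ 2 <= y ^+ 3 by rewrite [y ^+ 3]exprS ler_peMl //; lra.
have Lk2 : L%:R * k%:R <= (t%:R + 3) * y ^+ 3.
  rewrite -(ler_pM2l L0) mulrA -expr2; apply: le_trans L2k _.
  have -> : y ^+ 4 = y * y ^+ 3 by rewrite -exprS.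
  have : y * y ^+ 3 <= L%:R * y ^+ 3 by apply: ler_wpM2r.
  have : s * L%:R ^+ 2 <= L%:R * (t%:R * y ^+ 3).
    have -> : s * L%:R ^+ 2 = L%:R * (s * L%:R) by ring.
    apply: ler_wpM2l; first exact: ltW.
    by apply: le_trans sLt _; apply: ler_wpM2r.
  have : L%:R ^+ 2 <= L%:R * (2 * y ^+ 3).
    rewrite [L%:R ^+ 2]expr2; apply: ler_wpM2l; first exact: ltW.
    apply: le_trans Ly _; apply: ler_wpM2l => //; apply: le_trans y23.
    by rewrite expr2 ler_peMl //; lra.
  lra.
(* As p k / L = L k, the deviation 2 L k is the largest one allowed, and the leftover degree is 2 (L
   k + 2 L k) + t L k. *)
have main := @degree_arboricity_split R V G f f_ge2 t d m k ((6 + t) * L * k)%N s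
  (2 * (L%:R * k%:R)) ft dG aG s0.
have {main} : (degree_arboricity G f_ge2 <= 2 ^ (m + m) * k + 2 * ((6 + t) * L * k))%N.
  apply: main.
  - rewrite pL natrM dy mulrA ler_pdivlMr //; apply: le_trans sLw _.
    have -> : 16 * tau * y ^+ 3 * w = 2 * tau * y ^+ 3 * (8 * w) by ring.
    have -> : 2 * (t%:R * y ^+ 4) = 2 * t%:R * y ^+ 3 * y by ring.
    apply: ler_pM => //; [|lra|].
      by rewrite !mulr_ge0 //; lra.
    by apply: ler_wpM2r => //; lra.
  - rewrite pL [X in expR (- X)](_ : _ = 4%:R * ln d%:R).
      rewrite expRN expRM_natl lnK ?posrE ?dy // ler_pdivrMr ?exprn_gt0 // mul1r.
      by rewrite !natrM pL dy; apply: poly_le_expr16; rewrite // Ly ltW.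
    rewrite -wd natrM dy -exprMn sL -tauE; field.
    by rewrite !gt_eqF //; lra.
  - by rewrite pL; apply: ltW.
  - by rewrite !mulr_gt0.
  - by rewrite natrM pL [X in _ <= _ * X](_ : _ = L%:R * k%:R) //; field; rewrite gt_eqF.
  - rewrite [X in expR (- X)](_ : _ = L%:R * k%:R / 4); last first.
      by rewrite natrM pL; field; rewrite !gt_eqF.
    have := @poly_le_expR R y L%:R (L%:R * k%:R); rewrite !natrM pL.
    have -> : L%:R ^+ 2 * k%:R * (2 * L%:R) = 2 * L%:R ^+ 2 * (L%:R * k%:R) :> R by ring.
    by apply=> //; [lra|rewrite Ly ltW].
  - rewrite !natrM pL natrD le_eqVlt; apply/orP; left; apply/eqP; field.
    by rewrite gt_eqF.
rewrite -(ler_nat R) => /le_trans; apply.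
rewrite natrD !natrM pL natrD.
have : (6 + t%:R) * (L%:R * k%:R) <= (6 + t%:R) * ((t%:R + 3) * y ^+ 3).
  by apply: ler_wpM2l; lra.
have : 16 * tau * y ^+ 3 * w <= 16 * t%:R * y ^+ 3 * w.
  by apply: ler_wpM2r; [lra|apply: ler_wpM2r => //; lra].
lra.
Qed.

Lemma deg_le_max_degree_ratio (V : finType) (G : sgraph V) (f : V -> nat) v :
  (0 < f v)%N -> (deg G v <= max_degree_ratio G f * f v)%N.
Proof.
move=> f0; have f0r : 0 < (f v)%:R :> rat by rewrite ltr0n.
pose r : rat := (deg G v)%:R / (f v)%:R.
have le1 : (`|Num.ceil r|%N <= max_degree_ratio G f)%N.
  exact: (@leq_bigmax _ (fun v => `|Num.ceil ((deg G v)%:R / (f v)%:R : rat)|%N)).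
have le2 : r <= `|Num.ceil r|%N%:R.
  apply: le_trans (ceil_ge r) _; rewrite -[X in _ <= X]/(`|Num.ceil r|%N%:Z%:~R) ler_int.
  exact: lez_abs.
apply: (@leq_trans (`|Num.ceil r|%N * f v)%N); last by rewrite leq_mul2r le1 orbT.
by rewrite -(ler_nat rat) natrM -ler_pdivrMr.
Qed.

(** The degree restriction is vacuous here. This covers [d <= 1], where the logarithm leaves no room
    for an error. *)
Lemma degree_arboricity_le_arboricity (V : finType) (G : sgraph V) (f : V -> nat)
    (f_ge2 : forall v, (2 <= f v)%N) :
  (forall v, deg G v <= f v)%N -> (degree_arboricity G f_ge2 <= arboricity G)%N.
Proof.
move=> degf; apply: degree_arboricity_le; rewrite /arboricity.
case: ex_minnP => k /asboolP[c [ck cF]] _; exists c; split=> // i ik; split; first exact: cF.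
move=> v; apply: leq_trans (degf v); apply/subset_leq_card/subsetP => e.
by rewrite !inE => /andP[/andP[-> _] ->].
Qed.

Theorem theorem7 (R : realType) (t : nat) (ht : (2 <= t)%N) :
  exists c : R, 0 < c /\
    forall (V : finType) (G : sgraph V) (f : V -> nat)
      (f_ge2 : forall v, (2 <= f v)%N) (f_le_t : forall v, (f v <= t)%N),
      let d := maxn (max_degree_ratio G f) (arboricity G) in
      (degree_arboricity G f_ge2)%:R
        <= d%:R + c * d%:R `^ (3%:R / 4%:R) * (ln d%:R) `^ (1 / 2%:R).
Proof.
(* For [d >= 2] this bounds (ln d)^(1/2) from below, so terms without logarithm are absorbed at the
   price of a factor [1 / w2]. *)
pose w2 : R := (ln 2) `^ (1 / 2).
have ln2 : 0 < ln 2 :> R by apply: ln_gt0; lra.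
have w20 : 0 < w2 by apply: powR_gt0.
have t0 : 0 <= t%:R :> R by apply: ler0n.
(* The first summand pays for the greedy bound [2 * t * d] when [y < 256 + t], the second is the
   part free of [w] in [degree_arboricity_large]. *)
pose K : R := 2 * t%:R * (256 + t%:R) + (4 + 2 * (6 + t%:R) * (t%:R + 3)).
have K0 : 0 < K.
  have : 0 <= t%:R * (256 + t%:R) :> R by rewrite mulr_ge0 //; lra.
  have : 0 <= (6 + t%:R) * (t%:R + 3) :> R by rewrite mulr_ge0 //; lra.
  by rewrite /K; lra.
exists (16 * t%:R + K / w2); split; first by have := divr_gt0 K0 w20; lra.
move=> V G f f_ge2 f_le_t; set d := maxn _ _; cbv zeta.
have dG v : (deg G v <= d * f v)%N.
  apply: leq_trans (deg_le_max_degree_ratio _ _) _; first by apply: ltnW (f_ge2 v).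
  by rewrite leq_mul2r leq_maxl orbT.
have aG : (arboricity G <= d)%N by apply: leq_maxr.
have c0 : 0 <= 16 * t%:R + K / w2 by have := divr_gt0 K0 w20; lra.
have [d1|d2] := leqP d 1.
  apply: (@le_trans _ _ d%:R); last by rewrite lerDl !mulr_ge0 ?powR_ge0.
  rewrite ler_nat; apply: leq_trans aG; apply: degree_arboricity_le_arboricity => v.
  by apply: leq_trans (dG v) _; rewrite -{2}[f v]mul1n leq_mul2r d1 orbT.
have d2r : 2 <= d%:R :> R by rewrite ler_nat.
set x : R := d%:R; pose y := x `^ (1 / 4); pose w := ln x `^ (1 / 2).
have lnx : ln 2 <= ln x by rewrite ler_ln ?posrE //; lra.
have w2w : w2 <= w.
  by apply: ge0_ler_powR; rewrite ?nnegrE //; lra.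
have yE n : y ^+ n = x `^ (n%:R / 4).
  by rewrite -powR_mulrn ?powR_ge0 // -powRrM; congr (_ `^ _); field.
have y4 : x = y ^+ 4 by rewrite yE divff ?powRr1 //; lra.
have wE : w ^+ 2 = ln x.
  rewrite -powR_mulrn ?powR_ge0 // -powRrM mul1r mulVf ?pnatr_eq0 // powRr1 //; lra.
have y1 : 1 <= y.
  by rewrite -(@ler_pXn2r _ 4) ?nnegrE ?powR_ge0 // -y4 expr1n; lra.
have y3 : 0 <= y ^+ 3 by apply: exprn_ge0; lra.
rewrite -yE -/w.
have Kw : K <= K / w2 * w.
  by rewrite mulrAC ler_pdivlMr // ler_wpM2l // ltW.
have [yt|ty] := ltP y (256 + t%:R).
  have degt v : (deg G v <= t * d)%N.
    by apply: leq_trans (dG v) _; rewrite mulnC leq_mul2r f_le_t orbT.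
  apply: (@le_trans _ _ (2 * t * d)%:R).
    by rewrite ler_nat -mulnA; apply: degree_arboricity_le_deg.
  rewrite !natrM -/x {1}y4.
  have h1 : 2 * t%:R * y ^+ 4 <= 2 * t%:R * (256 + t%:R) * y ^+ 3.
    rewrite [y ^+ 4]exprS mulrA; apply: ler_wpM2r => //; apply: ler_wpM2l; lra.
  apply: le_trans h1 _.
  have h2 : 2 * t%:R * (256 + t%:R) * y ^+ 3 <= K * y ^+ 3.
    apply: ler_wpM2r => //.
    have : 0 <= (6 + t%:R) * (t%:R + 3) :> R by rewrite mulr_ge0 //; lra.
    by rewrite /K; lra.
  have := ler_wpM2r y3 Kw.
  have : 0 <= 16 * t%:R * w * y ^+ 3 by rewrite !mulr_ge0 // powR_ge0.
  lra.
have := @degree_arboricity_large R V G f f_ge2 t d y w ht f_le_t dG aG ty y4 _ wE.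
move=> /(_ (lt_le_trans w20 w2w)) /le_trans; apply.
rewrite [X in _ <= X + _]y4 lerD2l.
have := ler_wpM2r y3 Kw.
have : 0 <= t%:R * (256 + t%:R) * y ^+ 3 by rewrite !mulr_ge0 //; lra.
by rewrite /K; lra.
Qed.
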